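(* Let $A\in\mathbb{R}^{n\times d}$ have rows $a_1,\dots,a_n$, let $q\ge1$ be an integer, let $\mathcal{K}(x,z)=(x^{T}z)^q$, and let $\Phi\in\mathbb{R}^{n\times d^q}$ be the matrix whose rows are $\phi(a_1),\dots,\phi(a_n)$, where $\phi$ is the degree-$q$ monomial feature map; assume $\Phi$ has full row rank. Let $K\in\mathbb{R}^{n\times n}$, $K_{ij}=\mathcal{K}(a_i,a_j)$, with eigenvalues $\lambda_1\ge\dots\ge\lambda_n$, and let $1\le k<n$ with $\lambda_k>\lambda_{k+1}$. Let $b=f+\xi\in\mathbb{R}^n$ be as in the fixed design model, and let $\nu,\delta\in(0,1/2)$. If $R\in\mathbb{R}^{d^q\times t}$ is a TensorSketch matrix (independent of $b$) with $$t=\Omega\left(\frac{3^q\,\mathrm{Tr}(K)^2}{(\lambda_k-\lambda_{k+1})^2\nu^2\delta}\right)$$ columns, then with probability at least $1-\delta$ over $R$, $$\mathcal{E}(x_{\mathcal{K},R,k})\le\mathcal{E}(x_{\mathcal{K},k})+\frac{(2\nu+\nu^2)\|f\|_2^2}{n}.$$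
   Context: The feature map $\phi:\mathbb{R}^d\to\mathbb{R}^{d^q}$ is $\phi(z)=(z_{i_1}z_{i_2}\cdots z_{i_q})_{i_1,\dots,i_q\in\{1,\dots,d\}}$, so $\phi(x)^{T}\phi(z)=(x^{T}z)^q$ and $K=\Phi\Phi^{T}$. $V_{X,k}$ is the matrix of the top $k$ right singular vectors in a thin SVD of $X$ (any such decomposition), $X^{+}$ the Moore–Penrose pseudo-inverse. The rank-$k$ kernel PCR solution is $x_{\mathcal{K},k}=V_{\Phi,k}(\Phi V_{\Phi,k})^{+}b$, and the sketched one is $x_{\mathcal{K},R,k}=RV_{\Phi R,k}(\Phi RV_{\Phi R,k})^{+}b$. TensorSketch: choose independently at random $q$ hash functions $h_1,\dots,h_q:\{1,\dots,d\}\to\{1,\dots,t\}$, each 3-wise independent, and $q$ sign functions $g_1,\dots,g_q:\{1,\dots,d\}\to\{-1,+1\}$, each 4-wise independent. Define $H(i_1,\dots,i_q)=h_1(i_1)+\dots+h_q(i_q)\bmod t$ (identifying residues mod $t$ with $\{1,\dots,t\}$) and $G(i_1,\dots,i_q)=g_1(i_1)\cdots g_q(i_q)$ on $\{1,\dots,d\}^q$. The rows of $R$ are indexed by $\{1,\dots,d\}^q$, and row $(i_1,\dots,i_q)$ equals $G(i_1,\dots,i_q)\,e_{H(i_1,\dots,i_q)}^{T}$, with $e_j$ the $j$th standard basis vector of $\mathbb{R}^t$. Fixed design model: $\Phi$ and $f\in\mathbb{R}^n$ are fixed, $b=f+\xi$ where the entries of $\xi$ are independent with mean $0$ and variance $\sigma^2$.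 $x^\star$ is the minimum-norm minimizer of $\mathbb{E}[\|\Phi x-b\|_2^2/n]$, and $\mathcal{E}(\theta)=\mathbb{E}[\|\Phi\theta-\Phi x^\star\|_2^2/n]$, with expectation over $\xi$ only ($R$ held fixed). ''$t=\Omega(\cdot)$'' means $t$ is at least a sufficiently large absolute constant times the quantity in parentheses. *)

(* Defs.v *)
From HB Require Import structures.
From mathcomp Require Import all_boot all_order all_algebra.
From mathcomp Require Import all_classical all_reals all_analysis.

Set Implicit Arguments.
Unset Strict Implicit.
Unset Printing Implicit Defensive.

Import Order.TTheory GRing.Theory Num.Theory.
Local Open Scope classical_set_scope.
Local Open Scope ring_scope.

Section LinearAlgebra.
Variable R : realType.

Definition sqnorm2 n (v : 'cV[R]_n) : R := \sum_i v i 0 ^+ 2.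

Definition is_pinv m n (X : 'M[R]_(m, n)) (Y : 'M[R]_(n, m)) : Prop :=
  [/\ X *m Y *m X = X, Y *m X *m Y = Y,
      (X *m Y)^T = X *m Y & (Y *m X)^T = Y *m X].

(* The four Penrose equations have exactly one solution, so the default value
   of xget is never taken.  (mathcomp's pinvmx only satisfies the first two
   equations.) *)
Definition pinv m n (X : 'M[R]_(m, n)) : 'M[R]_(n, m) :=
  xget 0 [set Y | is_pinv X Y].

(* The common inner dimension is min(m, n), so zero singular values are
   listed, with corresponding singular vectors. *)
Definition thin_svd m n (X : 'M[R]_(m, n)) (U : 'M[R]_(m, minn m n))
    (s : 'rV[R]_(minn m n)) (V : 'M[R]_(n, minn m n)) : Prop :=
  [/\ X = U *m diag_mx s *m V^T, U^T *m U = 1%:M, V^T *m V = 1%:M,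
      (forall i, 0 <= s 0 i)
    & (forall i j : 'I_(minn m n), (i <= j)%N -> s 0 j <= s 0 i)].

Definition top_right_singular m n (X : 'M[R]_(m, n)) (k : nat)
    (W : 'M[R]_(n, k)) : Prop :=
  exists (U : 'M[R]_(m, minn m n)) (s : 'rV[R]_(minn m n))
    (V : 'M[R]_(n, minn m n)) (hk : (k <= minn m n)%N),
    thin_svd X U s V /\ W = colsub (widen_ord hk) V.

(* With multiplicity; the j-th eigenvalue (counted from 1) is lam`_(j.-1). *)
Definition ordered_eigenvalues n (M : 'M[R]_n) (lam : seq R) : Prop :=
  char_poly M = \prod_(x <- lam) ('X - x%:P) /\ sorted >=%R lam.

End LinearAlgebra.

Section Kernel.
Variable R : realType.

(* The index set {1, ..., d}^q is {ffun 'I_q -> 'I_d}; its d ^ q elements are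
   numbered by enum_val. *)
Definition multi_index d q (j : 'I_#|{ffun 'I_q -> 'I_d}|) :
    {ffun 'I_q -> 'I_d} := enum_val j.

Definition feature_map d q (z : 'rV[R]_d) : 'rV[R]_(#|{ffun 'I_q -> 'I_d}|) :=
  \row_j \prod_(l < q) z 0 (multi_index j l).

Definition feature_mx n d q (A : 'M[R]_(n, d)) :
    'M[R]_(n, #|{ffun 'I_q -> 'I_d}|) :=
  \matrix_(i < n) feature_map q (row i A).

Definition poly_kernel d q (x z : 'rV[R]_d) : R := (x *m z^T) 0 0 ^+ q.

Definition kernel_mx n d q (A : 'M[R]_(n, d)) : 'M[R]_n :=
  \matrix_(i, j) poly_kernel q (row i A) (row j A).

(* V stands for a top-k right singular matrix of X. *)
Definition pcr_sol n p k (X : 'M[R]_(n, p)) (V : 'M[R]_(p, k))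
    (b : 'cV[R]_n) : 'cV[R]_p :=
  V *m pinv (X *m V) *m b.

(* V stands for a top-k right singular matrix of X *m S. *)
Definition sketched_pcr_sol n p t k (X : 'M[R]_(n, p)) (S : 'M[R]_(p, t))
    (V : 'M[R]_(t, k)) (b : 'cV[R]_n) : 'cV[R]_p :=
  S *m V *m pinv (X *m S *m V) *m b.

End Kernel.

Section Independence.
Variables (R : realType) (disp : measure_display) (T : measurableType disp).
Variable P : probability T R.

Definition rv_events (U : Type) (X : T -> U) (G : set (set U)) : set (set T) :=
  [set X @^-1` B | B in G].

Definition indep_families (I : finType) (F : I -> set (set T)) : Prop :=
  forall E : I -> set T, (forall i, F i (E i)) ->
  forall J : {set I},
    P (\bigcap_(i in [set` J]) E i) = (\prod_(i in J) P (E i))%E.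

Definition indep2 (F G : set (set T)) : Prop :=
  forall A B, F A -> G B -> P (A `&` B) = (P A * P B)%E.

(* The Borel sigma-algebra, generated by the coordinate maps. *)
Definition cV_borel n : set (set 'cV[R]_n) :=
  <<s [set C | exists (i : 'I_n) (B : set R),
         measurable B /\ C = [set v : 'cV[R]_n | B (v i 0)] ] >>.

(* As usual for hash families, the values are moreover uniform.  Sets S of
   size smaller than k are included to cover the case d < k. *)
Definition kwise_independent (k d : nat) (V : finType)
    (h : T -> {ffun 'I_d -> V}) : Prop :=
  forall S : {set 'I_d}, (#|S| <= k)%N -> forall c : 'I_d -> V,
    P [set w | forall i, i \in S -> h w i = c i]
    = ((#|V|%:R ^+ #|S|)^-1 : R)%:E.

End Independence.

Section TensorSketch.
Variable R : realType.

(* 'I_t is the set of least nonnegative representatives mod t. *)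
Definition tensor_hash d q t (h : 'I_q -> {ffun 'I_d -> 'I_t})
    (x : {ffun 'I_q -> 'I_d}) : nat :=
  ((\sum_(l < q) h l (x l)) %% t)%N.

(* A sign is encoded by a boolean s standing for (-1) ^ s. *)
Definition tensor_sign d q (g : 'I_q -> {ffun 'I_d -> bool})
    (x : {ffun 'I_q -> 'I_d}) : R :=
  \prod_(l < q) (-1) ^+ g l (x l).

Definition tensor_sketch d q t (h : 'I_q -> {ffun 'I_d -> 'I_t})
    (g : 'I_q -> {ffun 'I_d -> bool}) : 'M[R]_(#|{ffun 'I_q -> 'I_d}|, t) :=
  \matrix_(i, j) (tensor_sign g (multi_index i)
                  *+ (val j == tensor_hash h (multi_index i))).

Definition is_tensor_sketch (disp : measure_display) (T : measurableType disp)
    (P : probability T R) d q t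
    (S : T -> 'M[R]_(#|{ffun 'I_q -> 'I_d}|, t)) : Prop :=
  exists (h : 'I_q -> T -> {ffun 'I_d -> 'I_t})
         (g : 'I_q -> T -> {ffun 'I_d -> bool}),
  [/\ (forall l B, measurable (h l @^-1` B)) /\
      (forall l B, measurable (g l @^-1` B)),
      (forall l, kwise_independent P 3 (h l)),
      (forall l, kwise_independent P 4 (g l)),
      indep_families P (fun a : 'I_q + 'I_q =>
        match a with
        | inl l => rv_events (h l) discrete_measurable
        | inr l => rv_events (g l) discrete_measurable
        end)
    & forall w, S w = tensor_sketch (h^~ w) (g^~ w)].

End TensorSketch.

Section FixedDesign.
Variables (R : realType) (disp : measure_display) (T : measurableType disp).
Variable P : probability T R.

Definition risk n p (X : 'M[R]_(n, p)) (b : T -> 'cV[R]_n) (x : 'cV[R]_p) :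
    \bar R :=
  ('E_P[fun w => (sqnorm2 (X *m x - b w) / n%:R)%R])%E.

Definition min_norm_minimizer p (F : 'cV[R]_p -> \bar R) (x : 'cV[R]_p) : Prop :=
  (forall y, (F x <= F y)%E) /\
  (forall y, (forall z, (F y <= F z)%E) -> sqnorm2 x <= sqnorm2 y).

(* theta is an estimator, random through the observations only. *)
Definition excess_risk n p (X : 'M[R]_(n, p)) (xstar : 'cV[R]_p)
    (theta : T -> 'cV[R]_p) : \bar R :=
  ('E_P[fun w => (sqnorm2 (X *m theta w - X *m xstar) / n%:R)%R])%E.

End FixedDesign.

(* Main.v *)
Require Import Defs.
From HB Require Import structures.
From mathcomp Require Import all_boot all_order all_algebra.
From mathcomp Require Import ring lra.
From mathcomp Require Import all_classical all_reals all_analysis.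
From mathcomp Require Import measurable_realfun.

Set Implicit Arguments.
Unset Strict Implicit.
Unset Printing Implicit Defensive.

Import Order.TTheory GRing.Theory Num.Theory.
Local Open Scope classical_set_scope.
Local Open Scope ring_scope.

(** Write P for the projection onto the span of Phi V and Q for the projection
    onto the span of Phi S VS.  Because Phi has full row rank, Phi xstar = f,
    and since the noise is white the excess risk of an estimator whose fitted
    values are Q b is (|Q f - f|^2 + sigma^2 |Q|_F^2) / n
    ([noise_sqnorm_mean]).  Both projections have rank at most k and P has
    rank exactly k, so sketching does not increase the variance term, and the
    bias term grows by at most (2 nu + nu^2) |f|^2 as soon as |P - Q|_F <= nu
    ([bias_perturbation]).

    The distance from P to Q is controlled by a variational form of the
    Davis-Kahan theorem ([pcproj_davis_kahan]).  By Ky Fan's principle Q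
    captures at least as much of the trace of the sketched Gram matrix
    Phi S S^T Phi^T as P does ([pcproj_captures_most]), whereas against
    K = Phi Phi^T it captures less than P by at least gap |P - Q|_F^2 / 2
    ([pcproj_gap]).  Comparing the two through Cauchy-Schwarz gives
    gap |P - Q|_F <= 2 |Phi S S^T Phi^T - K|_F.  The rank of Q enters only as
    an upper bound, so vanishing singular values of Phi S are harmless.

    It remains to see that the expectation of |Phi S S^T Phi^T - K|_F^2 is at
    most (3^q / t) Tr(K)^2 ([sketch_gram_moment]); Markov's inequality then
    yields the theorem with C = 4 ([tensor_sketch_whp]).  The (a, b) entry of
    the error is a sum over pairs of distinct multi-indices.  Expanding its
    square, the signs annihilate all quadruples of multi-indices that do not
    pair up in every coordinate ([tensor_sign_moment]), and a surviving
    quadruple costs at most the probability 1/t that two distinct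
    multi-indices collide ([tensor_collision]).  In one coordinate there are
    three ways to pair up four indices, and each contributes at most a product
    of four norms by Cauchy-Schwarz; this tensorises to the factor 3^q
    ([tensor_paired_sum_le]).  All these expectations are finite sums, weighted
    by the joint law of the hash and sign functions. *)

(** * Orthogonal projections and trace inequalities *)

Section Projections.
Variable R : realType.

Definition sqfrob m n (X : 'M[R]_(m, n)) : R := \sum_i \sum_j X i j ^+ 2.

Definition orthoproj n (Q : 'M[R]_n) : Prop := Q^T = Q /\ Q *m Q = Q.

Lemma sqfrob_trace m n (X : 'M[R]_(m, n)) : sqfrob X = \tr (X^T *m X).
Proof.
rewrite /sqfrob exchange_big /=; apply: eq_bigr => j _.
by rewrite mxE; apply: eq_bigr => i _; rewrite mxE expr2.
Qed.

Lemma sqnorm2_frob n (v : 'cV[R]_n) : sqnorm2 v = sqfrob v.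
Proof. by apply: eq_bigr => i _; rewrite big_ord1. Qed.

Lemma sqfrob_ge0 m n (X : 'M[R]_(m, n)) : 0 <= sqfrob X.
Proof. by apply: sumr_ge0 => i _; apply: sumr_ge0 => j _; apply: sqr_ge0. Qed.

Lemma sqfrobN m n (X : 'M[R]_(m, n)) : sqfrob (- X) = sqfrob X.
Proof. by apply: eq_bigr => i _; apply: eq_bigr => j _; rewrite mxE sqrrN. Qed.

Lemma sqnorm2_ge0 n (v : 'cV[R]_n) : 0 <= sqnorm2 v.
Proof. by rewrite sqnorm2_frob sqfrob_ge0. Qed.

Lemma sqnorm2_eq0 n (v : 'cV[R]_n) : sqnorm2 v <= 0 -> v = 0.
Proof.
move=> v0; have /eqP : sqnorm2 v = 0 by apply/le_anti; rewrite v0 sqnorm2_ge0.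
rewrite psumr_eq0 => [/allP h|i _]; last exact: sqr_ge0.
apply/colP => i; rewrite mxE; have := h i (mem_index_enum i).
by rewrite sqrf_eq0 => /eqP.
Qed.

Lemma cauchy_schwarz (I : finType) (x y : I -> R) :
  (\sum_i x i * y i) ^+ 2 <= (\sum_i x i ^+ 2) * (\sum_i y i ^+ 2).
Proof.
set a := \sum_i _ ^+ 2; set c := \sum_i _ ^+ 2; set b := \sum_i _.
have a0 : 0 <= a by apply: sumr_ge0 => i _; apply: sqr_ge0.
have h s t : 0 <= s ^+ 2 * a + 2 * s * t * b + t ^+ 2 * c.
  suff -> : s ^+ 2 * a + 2 * s * t * b + t ^+ 2 * c
            = \sum_i (s * x i + t * y i) ^+ 2.
    by apply: sumr_ge0 => i _; apply: sqr_ge0.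
  rewrite !mulr_sumr -!big_split /=; apply: eq_bigr => i _; ring.
have [a_eq0|a_neq0] := eqVneq a 0.
  (* The form is then affine in s, so a slope b <> 0 would make it negative;
     at the point below it equals -1. *)
  rewrite a_eq0 mul0r; have [->|b0] := eqVneq b 0; first by rewrite expr0n.
  have := h (- (c + 1) / (2 * b)) 1; rewrite a_eq0.
  rewrite (_ : _ + _ = -1) ?oppr_ge0 ?ler10 //.
  by field.
have {}a0 : 0 < a by rewrite lt_def a_neq0.
have := h (- b) a.
rewrite (_ : _ + _ = a * (a * c - b ^+ 2)); last by ring.
by rewrite pmulr_rge0 // subr_ge0.
Qed.

Lemma trace_mul_sq m n (X : 'M[R]_(m, n)) (Y : 'M[R]_(n, m)) :
  \tr (X *m Y) ^+ 2 <= sqfrob X * sqfrob Y.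
Proof.
have -> : \tr (X *m Y) = \sum_(p : 'I_m * 'I_n) X p.1 p.2 * Y p.2 p.1.
  rewrite -(pair_big xpredT xpredT (fun i j => X i j * Y j i)) /=.
  by apply: eq_bigr => i _; rewrite mxE.
apply: le_trans (cauchy_schwarz _ _) _.
rewrite -(pair_big xpredT xpredT (fun i j => X i j ^+ 2)) /=.
rewrite -(pair_big xpredT xpredT (fun i j => Y j i ^+ 2)) /=.
by rewrite [in X in _ * X <= _]exchange_big.
Qed.

Lemma sqnorm2_mulmx m n (X : 'M[R]_(m, n)) (v : 'cV[R]_n) :
  sqnorm2 (X *m v) <= sqfrob X * sqnorm2 v.
Proof.
rewrite /sqfrob mulr_suml; apply: ler_sum => i _.
by rewrite mxE; apply: cauchy_schwarz.
Qed.

Lemma orthoprojC n (Q : 'M[R]_n) : orthoproj Q -> orthoproj (1%:M - Q).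
Proof.
move=> [Qt QQ]; split; first by rewrite linearB /= Qt trmx1.
by rewrite mulmxBr mulmx1 mulmxBl mul1mx QQ subrr subr0.
Qed.

Lemma orthoproj_sandwich m n (Q : 'M[R]_n) (Z : 'M[R]_(n, m)) :
  orthoproj Q -> Z^T *m Q *m Z = (Q *m Z)^T *m (Q *m Z).
Proof. by case=> Qt QQ; rewrite trmx_mul Qt mulmxA -(mulmxA _ Q Q) QQ. Qed.

Lemma orthoproj_diag_ge0 m n (Q : 'M[R]_n) (Z : 'M[R]_(n, m)) i :
  orthoproj Q -> 0 <= (Z^T *m Q *m Z) i i.
Proof.
move/orthoproj_sandwich ->; rewrite mxE; apply: sumr_ge0 => j _.
by rewrite mxE -expr2 sqr_ge0.
Qed.

Lemma orthoproj_trace_ge0 m n (Q : 'M[R]_n) (Z : 'M[R]_(n, m)) :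
  orthoproj Q -> 0 <= \tr (Z^T *m Q *m Z).
Proof. by move=> hQ; apply: sumr_ge0 => i _; apply: orthoproj_diag_ge0. Qed.

Lemma orthoproj_diag_le1 m n (Q : 'M[R]_n) (U : 'M[R]_(n, m)) i :
  orthoproj Q -> U^T *m U = 1%:M -> (U^T *m Q *m U) i i <= 1.
Proof.
move=> /orthoprojC hQ UU; have := orthoproj_diag_ge0 U i hQ.
by rewrite mulmxBr mulmx1 mulmxBl UU !mxE eqxx subr_ge0.
Qed.

Lemma orthoproj_trace n (Q : 'M[R]_n) : orthoproj Q -> sqfrob Q = \tr Q.
Proof. by case=> Qt QQ; rewrite sqfrob_trace Qt QQ. Qed.

Lemma orthoproj_isometry m n (U : 'M[R]_(n, m)) :
  U^T *m U = 1%:M -> orthoproj (U *m U^T).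
Proof.
move=> UU; split; first by rewrite trmx_mul trmxK.
by rewrite mulmxA -(mulmxA U) UU mulmx1.
Qed.

Lemma orthoproj_trace_compress m n (Q : 'M[R]_n) (U : 'M[R]_(n, m)) :
  orthoproj Q -> U^T *m U = 1%:M -> \tr (U^T *m Q *m U) <= \tr Q.
Proof.
move=> hQ UU; have [Qt QQ] := hQ.
have := orthoproj_trace_ge0 Q (orthoprojC (orthoproj_isometry UU)).
rewrite Qt mulmxBr mulmx1 mulmxBl QQ linearB /= subr_ge0.
by rewrite mxtrace_mulC mulmxA QQ mulmxA mxtrace_mulC mulmxA.
Qed.

Lemma sqfrob_orthoprojB n (P Q : 'M[R]_n) : orthoproj P -> orthoproj Q ->
  sqfrob (P - Q) = \tr P + \tr Q - 2 * \tr (P *m Q).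
Proof.
move=> [Pt PP] [Qt QQ]; rewrite sqfrob_trace [(P - Q)^T]linearB /= Pt Qt.
rewrite mulmxBr !mulmxBl PP QQ !linearB /= (mxtrace_mulC Q P); ring.
Qed.

(** A linear programme on the hypersimplex.  Starting from the indicator of the
    first k indices, the weight w takes mass off them and puts no more mass
    back on the others; each unit removed loses at least a and each unit put
    back gains at most b.  The factor multiplying (a - b) / 2 is the mass
    removed plus the mass put back, and the former is at least half of it. *)
Lemma bathtub_gap m (l w : 'I_m -> R) (k : nat) (a b : R) :
  (k <= m)%N -> 0 <= b -> b <= a ->
  (forall i : 'I_m, (i < k)%N -> a <= l i) ->
  (forall i : 'I_m, (k <= i)%N -> l i <= b) ->
  (forall i, 0 <= w i) -> (forall i, w i <= 1) -> \sum_i w i <= k%:R ->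
  (a - b) * (k%:R + \sum_i w i - 2 * \sum_(i < m | (i < k)%N) w i) / 2
  <= \sum_(i < m | (i < k)%N) l i - \sum_i l i * w i.
Proof.
move=> km b0 ba la lb w0 w1 wk.
pose lo := \sum_(i < m | (i < k)%N) (1 - w i).
pose hi := \sum_(i < m | ~~ (i < k)%N) w i.
have card_k : \sum_(i < m | (i < k)%N) (1 : R) = k%:R.
  rewrite -(big_ord_widen_cond m xpredT (fun=> 1 : R)) //.
  by rewrite sumr_const card_ord.
have hlo : lo = k%:R - \sum_(i < m | (i < k)%N) w i.
  by rewrite /lo sumrB card_k.
have hw : \sum_i w i = k%:R - lo + hi.
  by rewrite hlo (bigID (fun i : 'I_m => (i < k)%N)) /= -/hi; ring.
have lo_gain : a * lo <= \sum_(i < m | (i < k)%N) l i * (1 - w i).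
  rewrite mulr_sumr; apply: ler_sum => i ik.
  by rewrite ler_wpM2r ?subr_ge0 ?w1 ?la.
have hi_loss : \sum_(i < m | ~~ (i < k)%N) l i * w i <= b * hi.
  rewrite mulr_sumr; apply: ler_sum => i; rewrite -leqNgt => ik.
  by rewrite ler_wpM2r ?w0 ?lb.
have -> : \sum_(i < m | (i < k)%N) l i - \sum_i l i * w i =
    \sum_(i < m | (i < k)%N) l i * (1 - w i)
    - \sum_(i < m | ~~ (i < k)%N) l i * w i.
  rewrite (bigID (fun i : 'I_m => (i < k)%N) xpredT (fun i => l i * w i)) /=.
  rewrite opprD addrA -sumrB; congr (_ - _).
  by apply: eq_bigr => i _; ring.
have -> : k%:R + \sum_i w i - 2 * \sum_(i < m | (i < k)%N) w i = lo + hi.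
  by rewrite hw hlo; ring.
nra.
Qed.

End Projections.

(** * Principal component projections and their perturbation *)

Section PrincipalComponents.
Variable R : realType.

(** The linear map from observations to the values fitted by regression on the
    principal components V of X. *)
Definition pcproj n p k (X : 'M[R]_(n, p)) (V : 'M[R]_(p, k)) : 'M[R]_n :=
  X *m V *m Defs.pinv (X *m V).

(** Existence of the pseudo-inverse is only ever needed for U D with U an
    isometry and D diagonal, where it can be written down from the inverse of
    D; the Penrose equations then transfer to the chosen one. *)
Lemma pinv_scaled_isometry m n (U : 'M[R]_(m, n)) (s : 'rV[R]_n) :
  U^T *m U = 1%:M -> is_pinv (U *m diag_mx s) (Defs.pinv (U *m diag_mx s)).
Proof.
move=> UU; rewrite /Defs.pinv.
apply: (@xgetPex _ _ [set Y | is_pinv (U *m diag_mx s) Y]).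
(* Division by zero gives zero, which is exactly the pseudo-inverse of 0. *)
pose r : 'rV[R]_n := \row_i (s 0 i)^-1.
have srs : diag_mx s *m diag_mx r *m diag_mx s = diag_mx s.
  rewrite !mulmx_diag; congr diag_mx; apply/rowP => i; rewrite !mxE.
  have [->|s0] := eqVneq (s 0 i) 0; first by rewrite !mul0r.
  by rewrite divff // mul1r.
have rsr : diag_mx r *m diag_mx s *m diag_mx r = diag_mx r.
  rewrite !mulmx_diag; congr diag_mx; apply/rowP => i; rewrite !mxE.
  have [->|s0] := eqVneq (s 0 i) 0; first by rewrite invr0 !mul0r.
  by rewrite mulVf // mul1r.
exists (diag_mx r *m U^T).
have YX : diag_mx r *m U^T *m (U *m diag_mx s) = diag_mx r *m diag_mx s.
  by rewrite mulmxA -(mulmxA _ U^T U) UU mulmx1.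
have XY : U *m diag_mx s *m (diag_mx r *m U^T)
          = U *m (diag_mx s *m diag_mx r) *m U^T by rewrite !mulmxA.
split.
- by rewrite -mulmxA YX -!mulmxA (mulmxA (diag_mx s)) srs.
- by rewrite YX mulmxA rsr.
- rewrite XY !trmx_mul trmxK !tr_diag_mx !mulmx_diag mulmxA.
  by congr (_ *m diag_mx _ *m _); apply/rowP => i; rewrite !mxE mulrC.
- rewrite YX trmx_mul !tr_diag_mx !mulmx_diag; congr diag_mx.
  by apply/rowP => i; rewrite !mxE mulrC.
Qed.

Lemma colsub_isometry n m k (U : 'M[R]_(n, m)) (g : 'I_k -> 'I_m) :
  injective g -> U^T *m U = 1%:M -> (colsub g U)^T *m colsub g U = 1%:M.
Proof.
move=> g_inj UU; apply/matrixP => i j.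
have /matrixP/(_ (g i) (g j)) := UU.
rewrite !mxE (inj_eq g_inj) => <-.
by apply: eq_bigr => l _; rewrite !mxE.
Qed.

Lemma widen_ord_inj k m (km : (k <= m)%N) : injective (widen_ord km).
Proof. by move=> i j /(congr1 val) /= ij; apply: val_inj. Qed.

Lemma thin_svd_colsub n p (X : 'M[R]_(n, p)) U s V k
    (g : 'I_k -> 'I_(minn n p)) : thin_svd X U s V ->
  X *m colsub g V = colsub g U *m diag_mx (colsub g s).
Proof.
case=> hX _ VV _ _.
have XV : X *m V = U *m diag_mx s by rewrite hX -mulmxA VV mulmx1.
apply/matrixP => i j; have /matrixP/(_ i (g j)) := XV.
rewrite mul_mx_diag mul_mx_diag !mxE => <-.
by apply: eq_bigr => l _; rewrite !mxE.
Qed.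

Lemma pcproj_orthoproj n p k (X : 'M[R]_(n, p)) (W : 'M[R]_(p, k)) :
  top_right_singular X W -> orthoproj (pcproj X W).
Proof.
case=> U [s [V [hk [svd ->]]]]; rewrite /pcproj (thin_svd_colsub _ svd).
have [_ UU _ _ _] := svd.
have [XYX _ sym _] := pinv_scaled_isometry (colsub (widen_ord hk) s)
  (colsub_isometry (widen_ord_inj (km := hk)) UU).
by split; rewrite ?sym // mulmxA XYX.
Qed.

Lemma pcproj_fixes n p k (X : 'M[R]_(n, p)) (W : 'M[R]_(p, k)) :
  top_right_singular X W -> pcproj X W *m (X *m W) = X *m W.
Proof.
case=> U [s [V [hk [svd ->]]]]; rewrite /pcproj (thin_svd_colsub _ svd).
have [_ UU _ _ _] := svd.
by have [] := pinv_scaled_isometry (colsub (widen_ord hk) s)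
  (colsub_isometry (widen_ord_inj (km := hk)) UU).
Qed.

(** The trace of X Y equals that of Y X, which here is a projection of size
    k, so that its k diagonal entries are at most 1. *)
Lemma pcproj_trace n p k (X : 'M[R]_(n, p)) (W : 'M[R]_(p, k)) :
  top_right_singular X W -> \tr (pcproj X W) <= k%:R.
Proof.
case=> U [s [V [hk [svd ->]]]]; rewrite /pcproj (thin_svd_colsub _ svd).
have [_ UU _ _ _] := svd.
have [_ YXY _ sym] := pinv_scaled_isometry (colsub (widen_ord hk) s)
  (colsub_isometry (widen_ord_inj (km := hk)) UU).
rewrite mxtrace_mulC.
set Q := (X in \tr X); have hQ : orthoproj Q.
  by split; rewrite ?sym // /Q mulmxA YXY.
have -> : k%:R = \sum_(i < k) (1 : R) by rewrite sumr_const card_ord.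
apply: ler_sum => i _.
have := @orthoproj_diag_le1 _ _ _ Q 1%:M i hQ.
by rewrite trmx1 !mul1mx !mulmx1; apply.
Qed.

Lemma thin_svd_gram n p (X : 'M[R]_(n, p)) U s V : thin_svd X U s V ->
  X *m X^T = U *m diag_mx (\row_i s 0 i ^+ 2) *m U^T.
Proof.
case=> hX UU VV _ _.
rewrite {1 2}hX !trmx_mul trmxK tr_diag_mx !mulmxA.
rewrite -(mulmxA _ V^T V) VV mulmx1 -(mulmxA U) mulmx_diag.
by congr (_ *m diag_mx _ *m _); apply/rowP => i; rewrite !mxE expr2.
Qed.

Lemma trace_proj_svd n p (X : 'M[R]_(n, p)) U s V (P : 'M[R]_n) :
  thin_svd X U s V ->
  \tr (P *m (X *m X^T)) = \sum_i s 0 i ^+ 2 * (U^T *m P *m U) i i.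
Proof.
move/thin_svd_gram ->; rewrite !mulmxA.
rewrite mxtrace_mulC !mulmxA; apply: eq_bigr => i _.
by rewrite mul_mx_diag !mxE mulrC.
Qed.

Lemma trace_top_svd n p (X : 'M[R]_(n, p)) U s V k
    (hk : (k <= minn n p)%N) : thin_svd X U s V ->
  let W := colsub (widen_ord hk) V in
  \tr (X *m W *m (X *m W)^T) = \sum_(i < minn n p | (i < k)%N) s 0 i ^+ 2.
Proof.
move=> svd W; rewrite /W (thin_svd_colsub _ svd) mxtrace_mulC trmx_mul.
have [_ UU _ _ _] := svd.
rewrite mulmxA -(mulmxA _ (_^T)) (colsub_isometry (@widen_ord_inj _ _ hk) UU).
rewrite mulmx1 tr_diag_mx mulmx_diag mxtrace_diag.
rewrite (eq_bigr (fun i => s 0 (widen_ord hk i) ^+ 2)); last first.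
  by move=> i _; rewrite !mxE expr2.
by rewrite big_ord_narrow.
Qed.

Lemma svd_sq_noninc n p (X : 'M[R]_(n, p)) U s V
    (i j : 'I_(minn n p)) : thin_svd X U s V ->
  (i <= j)%N -> s 0 j ^+ 2 <= s 0 i ^+ 2.
Proof.
by case=> _ _ _ s0 mono ij; rewrite ler_sqr ?nnegrE ?s0 ?mono.
Qed.

(** Ky Fan: the leading left singular vectors capture the largest share of
    X X^T among all projections of trace at most k.  When some of the first k
    singular values vanish, the projection below has smaller rank but it still
    captures this maximal share. *)
Lemma pcproj_captures_most n p k (X : 'M[R]_(n, p)) (W : 'M[R]_(p, k))
    (P : 'M[R]_n) : (0 < k)%N -> top_right_singular X W ->
  orthoproj P -> \tr P <= k%:R ->
  \tr (P *m (X *m X^T)) <= \tr (pcproj X W *m (X *m X^T)).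
Proof.
move=> k0 top hP trP; have hQ := pcproj_orthoproj top.
have QXW := pcproj_fixes top; move: (pcproj X W) hQ QXW => Q hQ QXW.
have [Qt QQ] := hQ.
case: top QXW => U [s [V [hk [svd ->]]]]; set W' := colsub _ V => QXW.
have [hX UU VV s0 mono] := svd.
apply: (@le_trans _ _ (\tr (X *m W' *m (X *m W')^T))).
  rewrite (trace_top_svd hk svd) (trace_proj_svd P svd) -subr_ge0.
  have ltk : (k.-1 < minn n p)%N by rewrite prednK.
  pose i0 := Ordinal ltk.
  have := @bathtub_gap _ _ (fun i => s 0 i ^+ 2)
    (fun i => (U^T *m P *m U) i i) k (s 0 i0 ^+ 2) (s 0 i0 ^+ 2) hk.
  rewrite subrr !mul0r; apply => //.
  - exact: sqr_ge0.
  - by move=> i ik; apply: svd_sq_noninc svd _; rewrite /= -ltnS prednK.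
  - move=> i ik; apply: svd_sq_noninc svd _.
    by rewrite /= (leq_trans (leq_pred k)).
  - by move=> i; apply: orthoproj_diag_ge0.
  - by move=> i; apply: orthoproj_diag_le1.
  - exact: le_trans (orthoproj_trace_compress hP UU) trP.
(* X X^T splits along the range of W' and its complement; the first part is
   fixed by Q and the second contributes a nonnegative trace. *)
have WW : W'^T *m W' = 1%:M.
  exact: (colsub_isometry (@widen_ord_inj _ _ hk) VV).
have := orthoproj_trace_ge0 (Q *m X)^T (orthoprojC (orthoproj_isometry WW)).
rewrite trmxK mulmxBr mulmx1 mulmxBl linearB /= subr_ge0 => h.
have eqW : Q *m X *m (W' *m W'^T) *m (Q *m X)^T
    = Q *m (X *m W') *m (Q *m (X *m W'))^T by rewrite !trmx_mul !mulmxA.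
have eqX : \tr (Q *m X *m (Q *m X)^T) = \tr (Q *m (X *m X^T)).
  by rewrite trmx_mul Qt !mulmxA [LHS]mxtrace_mulC !mulmxA QQ.
by move: h; rewrite eqW QXW eqX.
Qed.

(** The dimension m stands for min(n, p), which is n only up to a proof. *)
Lemma isometry_square n m (U : 'M[R]_(n, m)) : m = n ->
  U^T *m U = 1%:M -> U *m U^T = 1%:M.
Proof. by move=> mn; subst m => /mulmx1C. Qed.

Lemma char_poly_conj_diag n m (U : 'M[R]_(n, m)) (r : 'rV[R]_m) : m = n ->
  U^T *m U = 1%:M ->
  char_poly (U *m diag_mx r *m U^T) = \prod_(i < m) ('X - (r 0 i)%:P).
Proof.
move=> mn UU; subst m; have UU' := mulmx1C UU.
pose Up := map_mx polyC U.
have UUp : Up *m Up^T = 1%:M by rewrite /Up map_trmx -map_mxM UU' map_mx1.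
have -> : char_poly (U *m diag_mx r *m U^T) = char_poly (diag_mx r).
  rewrite /char_poly /char_poly_mx !map_mxM -map_trmx -/Up.
  have -> : 'X%:M - Up *m map_mx polyC (diag_mx r) *m Up^T
      = Up *m ('X%:M - map_mx polyC (diag_mx r)) *m Up^T.
    rewrite mulmxBr mulmxBl; congr (_ - _).
    by rewrite scalar_mxC -mulmxA UUp mulmx1.
  rewrite !det_mulmx mulrAC -det_mulmx UUp.
  by rewrite det1 mul1r.
rewrite char_poly_trig; first by apply: eq_bigr => i _; rewrite mxE eqxx.
exact: diag_mx_is_trig.
Qed.

Lemma row_free_minn n p (X : 'M[R]_(n, p)) : row_free X -> minn n p = n.
Proof.
by rewrite /row_free => /eqP rk; apply/minn_idPl; rewrite -{1}rk rank_leq_col.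
Qed.

(** The squared singular values and the eigenvalues are both sorted and both
    factor the characteristic polynomial of X X^T, hence they agree term by
    term. *)
Lemma eigenvalues_svd n p (X : 'M[R]_(n, p)) U s V (lam : seq R)
    (i : 'I_(minn n p)) : row_free X -> thin_svd X U s V ->
  ordered_eigenvalues (X *m X^T) lam -> lam`_i = s 0 i ^+ 2.
Proof.
move=> /row_free_minn mn svd [charX lam_sorted]; have [_ UU _ _ _] := svd.
pose sq := [seq s 0 j ^+ 2 | j <- enum 'I_(minn n p)].
have nth_sq (j : 'I_(minn n p)) : sq`_j = s 0 j ^+ 2.
  by rewrite (nth_map j) ?size_enum_ord // nth_ord_enum.
suff -> : lam = sq by rewrite nth_sq.
apply: (@sorted_eq _ (>=%R : rel R)) => //.
- by move=> x y z xy yz; apply: le_trans yz xy.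
- by move=> x y; rewrite andbC => /le_anti.
- apply/(sortedP 0) => j; rewrite size_map size_enum_ord => jm.
  have jm' := ltnW jm; rewrite (nth_sq (Ordinal jm)) (nth_sq (Ordinal jm')).
  exact: svd_sq_noninc svd _.
apply: prod_XsubC_eq; rewrite -charX (thin_svd_gram svd).
rewrite (char_poly_conj_diag _ mn UU) big_map big_enum.
by apply: eq_bigr => j _; rewrite mxE.
Qed.

Lemma trace_colsub n m k (U : 'M[R]_(n, m)) (M : 'M[R]_n) (hk : (k <= m)%N) :
  let Uk := colsub (widen_ord hk) U in
  \tr (Uk *m Uk^T *m M) = \sum_(i < m | (i < k)%N) (U^T *m M *m U) i i.
Proof.
move=> Uk; rewrite -mulmxA mxtrace_mulC big_ord_narrow.
apply: eq_bigr => i _; rewrite !mxE; apply: eq_bigr => j _; rewrite !mxE.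
by congr (_ * _); apply: eq_bigr => l _; rewrite !mxE.
Qed.

(** With positive leading singular values the principal components are mapped
    onto a basis of the span of the leading left singular vectors, so that
    the fitted values are the projection onto that span. *)
Lemma pcproj_isometry n p k (X : 'M[R]_(n, p)) U s V (hk : (k <= minn n p)%N) :
  thin_svd X U s V -> (forall i : 'I_(minn n p), (i < k)%N -> 0 < s 0 i) ->
  let Uk := colsub (widen_ord hk) U in
  pcproj X (colsub (widen_ord hk) V) = Uk *m Uk^T.
Proof.
move=> svd spos Uk; set W := colsub _ V.
have top : top_right_singular X W by exists U, s, V, hk.
have [Pt PP] := pcproj_orthoproj top; have := pcproj_fixes top.
rewrite (thin_svd_colsub _ svd) -/Uk mulmxA => PUD.
have [_ UU _ _ _] := svd.
have UkUk : Uk^T *m Uk = 1%:M.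
  exact: (colsub_isometry (@widen_ord_inj _ _ hk) UU).
have PU : pcproj X W *m Uk = Uk.
  pose r := \row_(i < k) (s 0 (widen_ord hk i))^-1.
  have DD : diag_mx (colsub (widen_ord hk) s) *m diag_mx r = 1%:M.
    rewrite mulmx_diag -diag_const_mx; congr diag_mx; apply/rowP => i.
    by rewrite !mxE divff // gt_eqF // spos /=.
  by rewrite -[LHS]mulmx1 -DD mulmxA PUD -mulmxA DD mulmx1.
have UP : Uk *m Uk^T *m pcproj X W = pcproj X W.
  rewrite {1}/pcproj (thin_svd_colsub _ svd) -/Uk !mulmxA -(mulmxA Uk) UkUk.
  by rewrite mulmx1 /pcproj (thin_svd_colsub _ svd).
move: (pcproj X W) Pt PU UP => P Pt PU UP.
by rewrite -Pt -UP !trmx_mul trmxK Pt mulmxA PU.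
Qed.

(** Curvature of Ky Fan's maximum: a projection that misses the leading
    eigenspace loses trace at a rate given by the eigenvalue gap.  The gap
    also forces the leading singular values to be positive. *)
Lemma pcproj_gap n p k (X : 'M[R]_(n, p)) (W : 'M[R]_(p, k)) (lam : seq R)
    (Q : 'M[R]_n) : row_free X -> (1 <= k < n)%N ->
  ordered_eigenvalues (X *m X^T) lam -> lam`_k < lam`_(k.-1) ->
  top_right_singular X W -> orthoproj Q -> \tr Q <= k%:R ->
  \tr (pcproj X W) = k%:R /\
  (lam`_(k.-1) - lam`_k) * sqfrob (pcproj X W - Q) / 2
  <= \tr ((pcproj X W - Q) *m (X *m X^T)).
Proof.
move=> rfX /andP[k0 kn] eigX gap top hQ trQ.
have hP := pcproj_orthoproj top; case: top hP => U [s [V [hk [svd ->]]]] hP.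
have mn := row_free_minn rfX; have [_ UU _ s0 mono] := svd.
have ltk : (k < minn n p)%N by rewrite mn.
have ltk1 : (k.-1 < minn n p)%N by rewrite (leq_ltn_trans (leq_pred k)).
have eig i := eigenvalues_svd i rfX svd eigX.
have eigk : lam`_k = s 0 (Ordinal ltk) ^+ 2 := eig (Ordinal ltk).
have eigk1 : lam`_(k.-1) = s 0 (Ordinal ltk1) ^+ 2 := eig (Ordinal ltk1).
have spos (i : 'I_(minn n p)) : (i < k)%N -> 0 < s 0 i.
  move=> ik; rewrite lt_def s0 andbT; apply: contraTneq gap => si0.
  rewrite -leNgt eigk1 (le_trans _ (_ : 0 <= _)) ?eigk ?sqr_ge0 //.
  suff -> : s 0 (Ordinal ltk1) = 0 by rewrite expr0n.
  by apply/le_anti; rewrite s0 -si0 mono //= -ltnS prednK.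
have trUk := trace_colsub U _ hk.
rewrite (pcproj_isometry hk svd spos) in hP *.
have diag1 i : (U^T *m U) i i = 1 by rewrite UU mxE eqxx.
have trP : \tr (colsub (widen_ord hk) U *m (colsub (widen_ord hk) U)^T)
           = k%:R.
  rewrite -[X in \tr X]mulmx1 trUk mulmx1.
  rewrite (eq_bigr (fun=> 1)); last by move=> i _; rewrite diag1.
  by rewrite (big_ord_narrow hk) /= sumr_const card_ord.
split=> //; rewrite sqfrob_orthoprojB // trP trUk.
have UU' := isometry_square mn UU.
have trQU : \tr Q = \sum_i (U^T *m Q *m U) i i.
  by rewrite -[LHS](congr1 _ (mul1mx _)) -UU' -mulmxA mxtrace_mulC.
rewrite mulmxBl linearB /= trUk (trace_proj_svd Q svd) trQU.
have -> : \sum_(i < minn n p | (i < k)%N) (U^T *m (X *m X^T) *m U) i i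
    = \sum_(i < minn n p | (i < k)%N) s 0 i ^+ 2.
  apply: eq_bigr => i _; rewrite (thin_svd_gram svd) !mulmxA UU mul1mx.
  by rewrite -mulmxA UU mulmx1 !mxE eqxx.
apply: bathtub_gap => //.
- by rewrite eigk sqr_ge0.
- exact: ltW.
- move=> i ik; rewrite eigk1; apply: svd_sq_noninc svd _.
  by rewrite /= -ltnS prednK.
- by move=> i ki; rewrite eigk; apply: svd_sq_noninc svd _.
- by move=> i; apply: orthoproj_diag_ge0.
- by move=> i; apply: orthoproj_diag_le1.
- by rewrite -trQU.
Qed.

(** Davis and Kahan in variational form: P maximises the trace against X X^T
    with curvature given by the gap, Q does at least as well as P against
    Y Y^T, so the difference of the two Gram matrices must pay for the
    distance from P to Q. *)
Lemma pcproj_davis_kahan n p t k (X : 'M[R]_(n, p)) (Y : 'M[R]_(n, t))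
    (V : 'M[R]_(p, k)) (W : 'M[R]_(t, k)) (lam : seq R) :
  row_free X -> (1 <= k < n)%N -> ordered_eigenvalues (X *m X^T) lam ->
  lam`_k < lam`_(k.-1) -> top_right_singular X V -> top_right_singular Y W ->
  (lam`_(k.-1) - lam`_k) ^+ 2 * sqfrob (pcproj X V - pcproj Y W)
  <= 4 * sqfrob (Y *m Y^T - X *m X^T).
Proof.
move=> rfX kn eigX gap topX topY; have [k0 _] := andP kn.
have hQ := pcproj_orthoproj topY; have trQ := pcproj_trace topY.
have hP := pcproj_orthoproj topX.
have [trP curv] := pcproj_gap rfX kn eigX gap topX hQ trQ.
have := pcproj_captures_most k0 topY hP; rewrite trP => /(_ (lexx _)).
move: (pcproj X V) (pcproj Y W) hP hQ curv {trP trQ} => P Q hP hQ curv capt.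
set D := sqfrob (P - Q) in curv *; set E := sqfrob _.
set g := _ - _ in curv *; have g0 : 0 < g by rewrite subr_gt0.
have D0 : 0 <= D by apply: sqfrob_ge0.
pose z := \tr ((P - Q) *m (X *m X^T - Y *m Y^T)).
have zg : g * D / 2 <= z.
  apply: le_trans curv _; rewrite /z mulmxBr [leRHS]linearB /=.
  rewrite lerBrDr gerDl [(P - Q) *m (Y *m _)]mulmxBl linearB /=.
  by rewrite subr_le0.
have zE : z ^+ 2 <= D * E.
  apply: le_trans (trace_mul_sq _ _) _; rewrite -/D.
  by rewrite /E -(sqfrobN (Y *m _ - _)) opprB.
have [D_eq0|D_neq0] := eqVneq D 0.
  by rewrite D_eq0 mulr0 mulr_ge0 // sqfrob_ge0.
have Dpos : 0 < D by rewrite lt_def D_neq0.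
have : (g * D / 2) ^+ 2 <= D * E.
  apply: le_trans zE; rewrite ler_sqr ?nnegrE //.
    by rewrite !mulr_ge0 // ?(ltW g0).
  by apply: le_trans zg; rewrite !mulr_ge0 // ?(ltW g0).
have -> : (g * D / 2) ^+ 2 = D * (g ^+ 2 * D / 4) by field.
by rewrite ler_pM2l // ler_pdivrMr // [E * _]mulrC.
Qed.

Lemma sqnorm2_add_le n (u v : 'cV[R]_n) (c nu : R) : 0 <= nu -> 0 <= c ->
  sqnorm2 u <= c -> sqnorm2 v <= nu ^+ 2 * c ->
  sqnorm2 (u + v) <= sqnorm2 u + (2 * nu + nu ^+ 2) * c.
Proof.
move=> nu0 c0 uc vc; pose z := \sum_i u i 0 * v i 0.
have -> : sqnorm2 (u + v) = sqnorm2 u + 2 * z + sqnorm2 v.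
  rewrite /sqnorm2 /z mulr_sumr -!big_split /=; apply: eq_bigr => i _.
  by rewrite mxE; ring.
have zle : z <= nu * c.
  apply: ler_normlW; rewrite -ler_sqr ?nnegrE ?mulr_ge0 //.
  rewrite real_normK ?num_real //.
  apply: le_trans (cauchy_schwarz _ _) _; rewrite exprMn [c ^+ 2]expr2 mulrCA.
  by apply: ler_pM; rewrite ?sqnorm2_ge0.
nra.
Qed.

End PrincipalComponents.

(** * Moments of k-wise independent functions *)

Section KwiseMass.
Variable R : realType.

(** The law of a k-wise independent function with uniform values, as a weight
    on the finite set of all functions. *)
Definition kwise_mass (k d : nat) (V : finType) (p : {ffun 'I_d -> V} -> R) :=
  forall S : {set 'I_d}, (#|S| <= k)%N -> forall c : 'I_d -> V,
  \sum_(y : {ffun 'I_d -> V} | [forall i in S, y i == c i]) p y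
  = (#|V|%:R ^+ #|S|)^-1.

Lemma kwise_mass_total k d (V : finType) (p : {ffun 'I_d -> V} -> R) :
  kwise_mass k p -> (0 < #|V|)%N -> \sum_y p y = 1.
Proof.
move=> hp /card_gt0P[v _].
have := hp finset.set0; rewrite cards0 => /(_ isT (fun=> v)).
rewrite expr0 invr1 => <-; apply: eq_bigl => y.
by apply/esym/forall_inP => i; rewrite inE.
Qed.

(** The restriction of y to S, extended by v0 so as to remain of the same type;
    its fixed points enumerate the patterns on S. *)
Definition restrict d (V : finType) (v0 : V) (S : {set 'I_d})
    (y : {ffun 'I_d -> V}) : {ffun 'I_d -> V} :=
  [ffun i => if i \in S then y i else v0].

Lemma restrict_eqP d (V : finType) (v0 : V) (S : {set 'I_d})
    (y c : {ffun 'I_d -> V}) : restrict v0 S c == c ->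
  (restrict v0 S y == c) = [forall i in S, y i == c i].
Proof.
move=> /eqP cS; apply/eqP/forall_inP => [<- i iS|yc]; first by rewrite ffunE iS.
rewrite -cS; apply/ffunP => i; rewrite !ffunE.
by case: ifP => // iS; rewrite (eqP (yc i iS)).
Qed.

(** Group the functions by their pattern on S: each pattern has the same
    probability. *)
Lemma kwise_mass_expect k d (V : finType) (v0 : V)
    (p phi : {ffun 'I_d -> V} -> R) (S : {set 'I_d}) :
  kwise_mass k p -> (#|S| <= k)%N ->
  (forall y, phi (restrict v0 S y) = phi y) ->
  \sum_y p y * phi y =
  (#|V|%:R ^+ #|S|)^-1 * \sum_(c | restrict v0 S c == c) phi c.
Proof.
move=> hp Sk phiS.
rewrite (partition_big (restrict v0 S) (fun c => restrict v0 S c == c)) /=;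
  last first.
  move=> y _; apply/eqP/ffunP => i; rewrite !ffunE.
  by case: ifP => // ->.
rewrite mulr_sumr; apply: eq_bigr => c cS.
rewrite (eq_bigr (fun y => p y * phi c)); last first.
  by move=> y /eqP <-; rewrite phiS.
rewrite -mulr_suml -(hp S Sk c); congr (_ * _).
by apply: eq_bigl => y; rewrite restrict_eqP.
Qed.

(** The quadruples in which every value occurs an even number of times. *)
Definition paired (D : eqType) (a b c e : D) : bool :=
  [|| (a == b) && (c == e), (a == c) && (b == e) | (a == e) && (b == c)].

Lemma paired_odd (D : eqType) (a b c e : D) : ~~ paired a b c e ->
  exists2 m, m \in [:: a; b; c; e] &
    (a == m) (+) (b == m) (+) (c == m) (+) (e == m).
Proof.
rewrite /paired !negb_or => /and3P[].
have [<-{b}|ab] := eqVneq a b => /=.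
  move=> ce _ _; have [ca|ca] := eqVneq c a.
    exists e; first by rewrite !inE eqxx !orbT.
    by rewrite -ca (negbTE ce) eqxx.
  exists c; first by rewrite !inE eqxx !orbT.
  by rewrite eq_sym (negbTE ca) eqxx eq_sym (negbTE ce).
have [<-{c}|ac] := eqVneq a c => /= [_ be _|_ _].
  exists b; first by rewrite !inE eqxx !orbT.
  by rewrite (negbTE ab) eqxx eq_sym (negbTE be).
have [<-{e}|ae] := eqVneq a e => /= [bc|_].
  exists b; first by rewrite !inE eqxx !orbT.
  by rewrite (negbTE ab) eqxx eq_sym (negbTE bc).
exists a; first by rewrite !inE eqxx.
by rewrite eqxx eq_sym (negbTE ab) eq_sym (negbTE ac) eq_sym (negbTE ae).
Qed.

Lemma kwise_sign_moment d (p : {ffun 'I_d -> bool} -> R) (a b c e : 'I_d) :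
  kwise_mass 4 p ->
  \sum_(y : {ffun _ -> _}) p y
    * ((-1) ^+ y a * (-1) ^+ y b * ((-1) ^+ y c * (-1) ^+ y e))
  = (paired a b c e)%:R.
Proof.
move=> hp; have [|/paired_odd[m mS odd_m]] := boolP (paired a b c e).
  move=> pr; rewrite -[RHS](kwise_mass_total hp) ?card_bool //.
  apply: eq_bigr => y _; case/or3P: pr => /andP[/eqP-> /eqP->];
  by case: (y _); case: (y _); rewrite /= !(expr0, expr1, mulr1, mul1r, mulrNN).
pose S := [set x in [:: a; b; c; e]]%SET.
have S4 : (#|S| <= 4)%N by rewrite cardsE; apply: card_size.
rewrite (kwise_mass_expect (v0 := false) hp S4); last first.
  by move=> y; rewrite !ffunE !inE !eqxx !orbT.
set s := \sum_(_ | _) _; suff -> : s = 0 by rewrite mulr0.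
(* Flipping the sign at m changes the sign of the whole sum. *)
pose flip (y : {ffun 'I_d -> bool}) := [ffun i => y i (+) (i == m)].
have flipK : involutive flip.
  by move=> y; apply/ffunP => i; rewrite !ffunE -addbA addbb addbF.
suff : s = - s by move/eqP; rewrite -addr_eq0 -mulr2n mulrn_eq0 => /eqP.
rewrite {1}/s (reindex_inj (inv_inj flipK)) -sumrN; apply: eq_big => y.
  have restrictE z : (restrict false S z == z)
      = [forall i, (i \in S) || ~~ z i].
    apply/eqP/forallP => [/ffunP zS i|zS].
      by have := zS i; rewrite ffunE; case: ifP => // _ <-.
    apply/ffunP => i; rewrite ffunE; have := zS i.
    by case: ifP => //= _ /negbTE.
  rewrite !restrictE; apply: eq_forallb => i; rewrite ffunE.
  case: (eqVneq i m) => [->|_]; last by rewrite addbF.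
  by rewrite inE mS.
move=> _; rewrite !ffunE !signr_addb.
have : (-1) ^+ ((a == m) (+) (b == m) (+) (c == m) (+) (e == m)) = -1 :> R.
  by rewrite odd_m.
rewrite !signr_addb => eN; rewrite -[RHS]mulrN1 -[X in _ = _ * X]eN; ring.
Qed.

Lemma kwise_collision d t (p : {ffun 'I_d -> 'I_t} -> R) (a b : 'I_d)
    (A B : nat) : kwise_mass 3 p -> a != b -> (0 < t)%N ->
  \sum_(y : {ffun _ -> _}) p y * ((y a + A) %% t == (y b + B) %% t)%N%:R
  <= t%:R^-1.
Proof.
move=> hp ab t0.
pose col (u : 'I_t * 'I_t) := ((u.1 + A) %% t == (u.2 + B) %% t)%N.
have tR : (0 : R) < t%:R by rewrite ltr0n.
have ba : (b == a) = false by rewrite eq_sym (negbTE ab).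
rewrite (eq_bigr (fun y : {ffun 'I_d -> 'I_t} =>
  if col (y a, y b) then p y else 0)); last first.
  by move=> y _; rewrite /col /=; case: ifP; rewrite ?mulr1 ?mulr0.
rewrite -big_mkcond.
rewrite (partition_big (fun y : {ffun 'I_d -> 'I_t} => (y a, y b)) col) //=.
rewrite (eq_bigr (fun=> (t%:R ^+ 2)^-1)); last first.
  move=> [u v] /= uv; pose c (i : 'I_d) := if i == a then u else v.
  have := hp [set a; b]%SET; rewrite cards2 ab => /(_ isT c).
  rewrite card_ord => <-; apply: eq_bigl => y.
  apply/andP/forall_inP => [[_ /eqP[ya yb]] i|yc].
    rewrite !inE /c => /orP[] /eqP->; first by rewrite eqxx ya.
    by rewrite ba yb.
  have /eqP := yc a (set21 _ _); rewrite /c eqxx => ya.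
  have /eqP := yc b (set22 _ _); rewrite /c ba => yb.
  by rewrite ya yb eqxx.
rewrite sumr_const -[leLHS]mulr_natl ler_pdivrMr ?exprn_gt0 //.
rewrite expr2 mulKf ?gt_eqF // ler_nat.
(* Modulo t the second residue determines the first. *)
rewrite -[leqRHS]card_ord -(card_in_imset (f := snd)) ?max_card //.
move=> [u v] [u' v']; rewrite -!topredE /= /col /= => /eqP uv /eqP u'v' vv'.
congr (_, _) => //; apply: val_inj.
rewrite -vv' -uv in u'v'; move/eqP: u'v'; rewrite eqn_modDr.
by rewrite !modn_small // => /eqP.
Qed.

End KwiseMass.

(** * Product weights on finite sets of functions *)

Section ProductMass.
Variables (R : realType) (I X : finType).

Definition prod_mass (p : I -> X -> R) (y : {ffun I -> X}) : R :=
  \prod_i p i (y i).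

Lemma prod_mass_factor (p phi : I -> X -> R) :
  \sum_y prod_mass p y * \prod_i phi i (y i)
  = \prod_i \sum_x p i x * phi i x.
Proof.
by rewrite bigA_distr_bigA; apply: eq_bigr => y _; rewrite big_split.
Qed.

Lemma prod_mass_total (p : I -> X -> R) :
  (forall i, \sum_x p i x = 1) -> \sum_y prod_mass p y = 1.
Proof. by move=> p1; rewrite -bigA_distr_bigA big1. Qed.

Definition update (y : {ffun I -> X}) (i0 : I) (x : X) : {ffun I -> X} :=
  [ffun i => if i == i0 then x else y i].

(** Fubini in the form of resampling: under a product mass, drawing one
    coordinate afresh does not change an expectation.  The map that exchanges
    the old and the new value preserves the joint mass. *)
Lemma prod_mass_resample (p : I -> X -> R) (i0 : I) (F : {ffun I -> X} -> R) :
  \sum_x p i0 x = 1 ->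
  \sum_y prod_mass p y * F y
  = \sum_y prod_mass p y * \sum_x p i0 x * F (update y i0 x).
Proof.
move=> p1; transitivity (\sum_y \sum_x prod_mass p y * p i0 x * F y).
  apply: eq_bigr => y _; rewrite -[LHS]mulr1 -p1 mulr_sumr.
  by apply: eq_bigr => x _; rewrite mulrAC.
transitivity (\sum_y \sum_x prod_mass p y * p i0 x * F (update y i0 x));
  last first.
  by apply: eq_bigr => y _; rewrite mulr_sumr; apply: eq_bigr => x _;
     rewrite mulrA.
rewrite !pair_bigA /=.
pose swap (z : {ffun I -> X} * X) := (update z.1 i0 z.2, z.1 i0).
have swapK : involutive swap.
  move=> [y x]; rewrite /swap /= !ffunE eqxx; congr (_, _).
  by apply/ffunP => i; rewrite !ffunE; case: eqP => [->|].
rewrite [RHS](reindex_inj (inv_inj swapK)) /=; apply: eq_bigr => -[y x] _ /=.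
have -> : update (update y i0 x) i0 (y i0) = y by have [] := swapK (y, x).
congr (_ * _); rewrite /prod_mass (bigD1 i0) //= [in RHS](bigD1 i0) //=.
rewrite ffunE eqxx [in RHS](eq_bigr (fun i => p i (y i))) => [|i /negbTE ii0].
  by rewrite mulrAC [RHS]mulrAC [p i0 x * _]mulrC.
by rewrite ffunE ii0.
Qed.

End ProductMass.

(** * Sums over paired quadruples of multi-indices *)

Section PairedSums.
Variable R : realType.

Definition norm2 (I : finType) (x : I -> R) : R := Num.sqrt (\sum_i x i ^+ 2).

Lemma norm2_ge0 (I : finType) (x : I -> R) : 0 <= norm2 x.
Proof. exact: sqrtr_ge0. Qed.

Lemma norm2_sq (I : finType) (x : I -> R) : norm2 x ^+ 2 = \sum_i x i ^+ 2.
Proof. by rewrite sqr_sqrtr // sumr_ge0 // => i _; apply: sqr_ge0. Qed.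

Lemma inner_le_norm2 (I : finType) (x y : I -> R) :
  \sum_i x i * y i <= norm2 x * norm2 y.
Proof.
apply: ler_normlW; rewrite -ler_sqr ?nnegrE ?mulr_ge0 ?norm2_ge0 //.
by rewrite real_normK ?num_real // exprMn !norm2_sq cauchy_schwarz.
Qed.

Lemma sum_delta (D : finType) (a : D) (g : D -> R) :
  \sum_b (a == b)%:R * g b = g a.
Proof.
rewrite (bigD1 a) //= eqxx mul1r big1 ?addr0 // => b ba.
by rewrite eq_sym (negbTE ba) mul0r.
Qed.

(** Each of the three ways to pair up four indices turns the sum into a product
    of two inner products. *)
Lemma paired_sum_le (D : finType) (x y z w : D -> R) :
  (forall a, 0 <= x a) -> (forall a, 0 <= y a) ->
  (forall a, 0 <= z a) -> (forall a, 0 <= w a) ->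
  \sum_(a : D * D) \sum_(b : D * D)
    (paired a.1 a.2 b.1 b.2)%:R * (x a.1 * y a.2 * (z b.1 * w b.2))
  <= 3 * (norm2 x * norm2 y * (norm2 z * norm2 w)).
Proof.
move=> x0 y0 z0 w0.
pose T (a : D * D) (b : D * D) := x a.1 * y a.2 * (z b.1 * w b.2).
have T0 a b : 0 <= T a b by rewrite !mulr_ge0.
apply: (@le_trans _ _ (\sum_a \sum_b ((a.1 == a.2) && (b.1 == b.2))%:R * T a b
  + \sum_a \sum_b ((a.1 == b.1) && (a.2 == b.2))%:R * T a b
  + \sum_a \sum_b ((a.1 == b.2) && (a.2 == b.1))%:R * T a b)).
  rewrite -!big_split; apply: ler_sum => a _ /=.
  rewrite -!big_split; apply: ler_sum => b _ /=.
  rewrite -!mulrDl ler_wpM2r ?(T0 a b) // -!natrD ler_nat /paired.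
  by do 3!case: (_ && _).
have e1 : \sum_a \sum_b ((a.1 == a.2) && (b.1 == b.2))%:R * T a b
    = (\sum_a x a * y a) * (\sum_a z a * w a).
  rewrite -(pair_bigA _ (fun a1 a2 => \sum_(b : D * D)
    ((a1 == a2) && (b.1 == b.2))%:R * T (a1, a2) b)) /= mulr_suml.
  apply: eq_bigr => a1 _.
  rewrite (eq_bigr (fun a2 => (a1 == a2)%:R *
    (x a1 * y a2 * \sum_b z b * w b))) ?sum_delta // => a2 _.
  rewrite -(pair_bigA _ (fun b1 b2 => ((a1 == a2) && (b1 == b2))%:R
    * T (a1, a2) (b1, b2))) /= !mulr_sumr; apply: eq_bigr => b1 _.
  rewrite (eq_bigr (fun b2 => (b1 == b2)%:R * ((a1 == a2)%:R
    * (x a1 * y a2 * (z b1 * w b2))))) ?sum_delta // => b2 _.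
  by rewrite -mulnb natrM /T /=; ring.
have e2 : \sum_a \sum_b ((a.1 == b.1) && (a.2 == b.2))%:R * T a b
    = (\sum_a x a * z a) * (\sum_a y a * w a).
  rewrite -(pair_bigA _ (fun a1 a2 => \sum_(b : D * D)
    ((a1 == b.1) && (a2 == b.2))%:R * T (a1, a2) b)) /= mulr_suml.
  apply: eq_bigr => a1 _; rewrite mulr_sumr; apply: eq_bigr => a2 _.
  rewrite (eq_bigr (fun b => ((a1, a2) == b)%:R * T (a1, a2) b)).
    by rewrite sum_delta /T /=; ring.
  by move=> [b1 b2] _; rewrite xpair_eqE.
have e3 : \sum_a \sum_b ((a.1 == b.2) && (a.2 == b.1))%:R * T a b
    = (\sum_a x a * w a) * (\sum_a y a * z a).
  rewrite -(pair_bigA _ (fun a1 a2 => \sum_(b : D * D)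
    ((a1 == b.2) && (a2 == b.1))%:R * T (a1, a2) b)) /= mulr_suml.
  apply: eq_bigr => a1 _; rewrite mulr_sumr; apply: eq_bigr => a2 _.
  rewrite (eq_bigr (fun b => ((a2, a1) == b)%:R * T (a1, a2) b)).
    by rewrite sum_delta /T /=; ring.
  by move=> [b1 b2] _; rewrite xpair_eqE andbC.
have nn (f g : D -> R) : (forall a, 0 <= f a) -> (forall a, 0 <= g a) ->
    0 <= \sum_a f a * g a.
  by move=> f0 g0; apply: sumr_ge0 => a _; rewrite mulr_ge0.
rewrite e1 e2 e3.
apply: (@le_trans _ _ (norm2 x * norm2 y * (norm2 z * norm2 w)
  + norm2 x * norm2 z * (norm2 y * norm2 w)
  + norm2 x * norm2 w * (norm2 y * norm2 z))).
  by rewrite !lerD // ler_pM ?nn // inner_le_norm2.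
by rewrite le_eqVlt; apply/orP; left; apply/eqP; ring.
Qed.

Section Multi.
Variable D : finType.

Definition fcons q (a : D) (i : {ffun 'I_q -> D}) : {ffun 'I_q.+1 -> D} :=
  [ffun l => if unlift ord0 l is Some l' then i l' else a].

Lemma fcons0 q a (i : {ffun 'I_q -> D}) : fcons a i ord0 = a.
Proof. by rewrite ffunE unlift_none. Qed.

Lemma fconsS q a (i : {ffun 'I_q -> D}) l : fcons a i (lift ord0 l) = i l.
Proof. by rewrite ffunE liftK. Qed.

Lemma sum_fcons q (F : {ffun 'I_q.+1 -> D} -> R) :
  \sum_i F i = \sum_a \sum_i F (fcons a i).
Proof.
rewrite pair_bigA /=.
rewrite (reindex_onto (fun z : D * {ffun 'I_q -> D} => fcons z.1 z.2)
  (fun i : {ffun 'I_q.+1 -> D} => (i ord0, [ffun l => i (lift ord0 l)]))) /=.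
  apply: eq_bigl => -[a i] /=; rewrite fcons0 xpair_eqE eqxx /=.
  by apply/eqP/ffunP => l; rewrite ffunE fconsS.
move=> i _; apply/ffunP => l.
by case: (unliftP ord0 l) => [l' ->|->]; rewrite ?fcons0 // fconsS ffunE.
Qed.

Lemma norm2_fcons q (x : {ffun 'I_q.+1 -> D} -> R) :
  norm2 x = norm2 (fun a => norm2 (fun i => x (fcons a i))).
Proof.
rewrite {1 2}/norm2 sum_fcons; congr Num.sqrt.
by apply: eq_bigr => a _; rewrite norm2_sq.
Qed.

Lemma sum_fcons2 q (F : {ffun 'I_q.+1 -> D} * {ffun 'I_q.+1 -> D} -> R) :
  \sum_u F u
  = \sum_(a : D * D) \sum_(u : {ffun 'I_q -> D} * {ffun 'I_q -> D})
      F (fcons a.1 u.1, fcons a.2 u.2).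
Proof.
transitivity (\sum_i \sum_j F (i, j)).
  by rewrite pair_bigA; apply: eq_bigr => -[].
rewrite sum_fcons -(pair_bigA _ (fun a b => \sum_(u : {ffun 'I_q -> D} *
  {ffun 'I_q -> D}) F (fcons a u.1, fcons b u.2))) /=.
apply: eq_bigr => a _; rewrite (eq_bigr (fun i => \sum_b \sum_j
  F (fcons a i, fcons b j))); last by move=> i _; rewrite sum_fcons.
rewrite exchange_big; apply: eq_bigr => b _.
by rewrite -(pair_bigA _ (fun i j => F (fcons a i, fcons b j))).
Qed.

Lemma sum_ffun0 (F : {ffun 'I_0 -> D} -> R) :
  \sum_i F i = F (ffun0 (card_ord 0) : {ffun 'I_0 -> D}).
Proof.
rewrite (bigD1 (ffun0 (card_ord 0) : {ffun 'I_0 -> D})) //= big1 ?addr0 // => i.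
by case/eqP; apply/ffunP => -[].
Qed.

(** The single-coordinate bound tensorises, by induction on the number of
    coordinates: for fixed first coordinates the inner sum is bounded by the
    product of the norms of the four slices, and these norms are themselves
    functions of one coordinate. *)
Lemma tensor_paired_sum_le q (x y z w : {ffun 'I_q -> D} -> R) :
  (forall i, 0 <= x i) -> (forall i, 0 <= y i) ->
  (forall i, 0 <= z i) -> (forall i, 0 <= w i) ->
  \sum_(u : {ffun 'I_q -> D} * {ffun 'I_q -> D})
  \sum_(v : {ffun 'I_q -> D} * {ffun 'I_q -> D})
    (\prod_l (paired (u.1 l) (u.2 l) (v.1 l) (v.2 l))%:R)
    * (x u.1 * y u.2 * (z v.1 * w v.2))
  <= 3 ^+ q * (norm2 x * norm2 y * (norm2 z * norm2 w)).
Proof.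
elim: q x y z w => [|q IH] x y z w x0 y0 z0 w0.
  rewrite expr0 mul1r -(pair_bigA _ (fun i j : {ffun 'I_0 -> D} => \sum_(v :
    {ffun 'I_0 -> D} * {ffun 'I_0 -> D}) (\prod_l (paired (i l) (j l) (v.1 l)
    (v.2 l))%:R) * (x i * y j * (z v.1 * w v.2)))) /= !sum_ffun0.
  set e := (ffun0 _ : {ffun 'I_0 -> D}).
  rewrite -(pair_bigA _ (fun k o : {ffun 'I_0 -> D} =>
    (\prod_l (paired (e l) (e l) (k l) (o l))%:R) * (x e * y e * (z k * w o)))) /=.
  rewrite !sum_ffun0 -/e big_ord0 mul1r.
  by rewrite /norm2 !sum_ffun0 -/e !sqrtr_sqr !ger0_norm.
rewrite sum_fcons2.
under eq_bigr => a _ do under eq_bigr => u _ do rewrite sum_fcons2.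
under eq_bigr => a _ do rewrite exchange_big.
pose X a := norm2 (fun i => x (fcons a i)).
pose Y a := norm2 (fun i => y (fcons a i)).
pose Z a := norm2 (fun i => z (fcons a i)).
pose W a := norm2 (fun i => w (fcons a i)).
apply: (@le_trans _ _ (\sum_(a : D * D) \sum_(b : D * D)
  3 ^+ q * ((paired a.1 a.2 b.1 b.2)%:R
   * (X a.1 * Y a.2 * (Z b.1 * W b.2))))).
  apply: ler_sum => a _; apply: ler_sum => b _.
  rewrite mulrCA.
  apply: le_trans (ler_wpM2l (ler0n _ _) (IH _ _ _ _ (fun i => x0 (fcons a.1 i))
    (fun i => y0 (fcons a.2 i)) (fun i => z0 (fcons b.1 i))
    (fun i => w0 (fcons b.2 i)))).
  rewrite mulr_sumr; apply: ler_sum => u _.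
  rewrite mulr_sumr; apply: ler_sum => v _ /=.
  rewrite [leRHS]mulrA big_ord_recl !fcons0.
  rewrite le_eqVlt; apply/orP; left; apply/eqP.
  by congr (_ * _ * _); apply: eq_bigr => l _; rewrite !fconsS.
under eq_bigr => a _ do rewrite -mulr_sumr.
rewrite -mulr_sumr exprSr -mulrA ler_wpM2l ?exprn_ge0 //.
rewrite (norm2_fcons x) (norm2_fcons y) (norm2_fcons z) (norm2_fcons w).
by apply: paired_sum_le => a; apply: norm2_ge0.
Qed.

End Multi.
End PairedSums.

(** * Second moment of the error of the sketched Gram matrix *)

Section SketchMoment.
Variables (R : realType) (d q t : nat).
Variable p : 'I_q -> {ffun 'I_d -> 'I_t} -> R.
Variable r : 'I_q -> {ffun 'I_d -> bool} -> R.
Hypothesis t_gt0 : (0 < t)%N.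
Hypothesis p_ge0 : forall l y, 0 <= p l y.
Hypothesis p_kwise : forall l, kwise_mass 3 (p l).
Hypothesis r_kwise : forall l, kwise_mass 4 (r l).

Local Notation idx := {ffun 'I_q -> 'I_d}.
Local Notation hashes := {ffun 'I_q -> {ffun 'I_d -> 'I_t}}.
Local Notation signs := {ffun 'I_q -> {ffun 'I_d -> bool}}.

Lemma hash_mass1 l : \sum_y p l y = 1.
Proof. by apply: kwise_mass_total (p_kwise l) _; rewrite card_ord. Qed.

Lemma prod_hash_mass_ge0 (h : hashes) : 0 <= prod_mass p h.
Proof. by apply: prodr_ge0 => l _. Qed.

(** Two distinct multi-indices differ in some coordinate; resampling the hash
    of that coordinate alone makes their residues collide with probability
    1/t. *)
Lemma tensor_collision (i j : idx) : i != j ->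
  \sum_(h : hashes) prod_mass p h * (tensor_hash h i == tensor_hash h j)%:R
  <= t%:R^-1.
Proof.
move=> ij; have [l0 il0] : exists l0, i l0 != j l0.
  apply/existsP; rewrite -negb_forall; apply: contra ij => /forallP h.
  by apply/eqP/ffunP => l; apply/eqP.
rewrite (prod_mass_resample (i0 := l0)) ?hash_mass1 //.
rewrite -[leRHS]mul1r -[X in _ <= X * _](prod_mass_total hash_mass1) mulr_suml.
apply: ler_sum => h _; apply: ler_wpM2l; first exact: prod_hash_mass_ge0.
pose rest (k : idx) := (\sum_(l < q | l != l0) h l (k l))%N.
apply: le_trans (kwise_collision (rest i) (rest j) (p_kwise l0) il0 t_gt0).
rewrite le_eqVlt; apply/orP; left; apply/eqP; apply: eq_bigr => y _.
have hashE (k : idx) :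
    tensor_hash (update h l0 y) k = ((y (k l0) + rest k) %% t)%N.
  rewrite /tensor_hash (bigD1 l0) //= ffunE eqxx; congr (modn (_ + _) _).
  by apply: eq_bigr => l /negbTE ll0; rewrite ffunE ll0.
by rewrite !hashE.
Qed.

Lemma tensor_sign_moment (i j k e : idx) :
  \sum_(g : signs) prod_mass r g * (tensor_sign R g i * tensor_sign R g j
    * (tensor_sign R g k * tensor_sign R g e))
  = \prod_l (paired (i l) (j l) (k l) (e l))%:R.
Proof.
rewrite (eq_bigr (fun l => \sum_y r l y * ((-1) ^+ y (i l) * (-1) ^+ y (j l)
  * ((-1) ^+ y (k l) * (-1) ^+ y (e l))))); last first.
  by move=> l _; rewrite kwise_sign_moment.
rewrite -prod_mass_factor; apply: eq_bigr => g _.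
by rewrite /tensor_sign -!big_split.
Qed.

(** The contribution of pairs of distinct multi-indices to the sketched inner
    product of x and y; equal multi-indices contribute the exact one. *)
Definition cross_term (h : hashes) (g : signs) (x y : idx -> R) : R :=
  \sum_(u : idx * idx) (u.1 != u.2)%:R * (x u.1 * y u.2)
   * (tensor_sign R g u.1 * tensor_sign R g u.2
      * (tensor_hash h u.1 == tensor_hash h u.2)%:R).

(** After expanding the square, the signs leave only the quadruples of
    multi-indices that pair up in each coordinate, and each of them costs at
    most one collision probability 1/t. *)
Lemma cross_term_moment (x y : idx -> R) :
  \sum_(h : hashes) prod_mass p h * \sum_(g : signs) prod_mass r g
    * cross_term h g x y ^+ 2
  <= 3 ^+ q / t%:R * ((\sum_i x i ^+ 2) * (\sum_i y i ^+ 2)).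
Proof.
pose c (u : idx * idx) := (u.1 != u.2)%:R * (x u.1 * y u.2).
pose G (g : signs) (u : idx * idx) := tensor_sign R g u.1 * tensor_sign R g u.2.
pose H (h : hashes) (u : idx * idx) : R :=
  (tensor_hash h u.1 == tensor_hash h u.2)%:R.
pose pr (u v : idx * idx) : R :=
  \prod_l (paired (u.1 l) (u.2 l) (v.1 l) (v.2 l))%:R.
have pr0 u v : 0 <= pr u v by apply: prodr_ge0.
have H0 h u : 0 <= H h u by [].
have H1 h u : H h u <= 1 by rewrite /H lern1; case: (_ == _).
have -> : \sum_(h : hashes) prod_mass p h * \sum_(g : signs) prod_mass r g
    * cross_term h g x y ^+ 2
  = \sum_u \sum_v c u * c v * (pr u v * \sum_h prod_mass p h * (H h u * H h v)).
  under eq_bigr => h _.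
    have -> : \sum_(g : signs) prod_mass r g * cross_term h g x y ^+ 2
        = \sum_u \sum_v c u * c v * (pr u v * (H h u * H h v)).
      rewrite (eq_bigr (fun g => \sum_u \sum_v c u * c v * (H h u * H h v)
         * (prod_mass r g * (G g u * G g v)))); last first.
        move=> g _; rewrite expr2 /cross_term mulr_suml mulr_sumr.
        apply: eq_bigr => u _; rewrite !mulr_sumr; apply: eq_bigr => v _.
        by rewrite /c /G /H; ring.
      rewrite exchange_big; apply: eq_bigr => u _.
      rewrite exchange_big; apply: eq_bigr => v _.
      by rewrite -mulr_sumr tensor_sign_moment /pr; ring.
    over.
  under eq_bigr => h _ do rewrite mulr_sumr.
  rewrite exchange_big; apply: eq_bigr => u _.
  under eq_bigr => h _ do rewrite mulr_sumr.
  rewrite exchange_big; apply: eq_bigr => v _.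
  by rewrite !mulr_sumr; apply: eq_bigr => h _; ring.
pose ax i := `|x i|; pose ay i := `|y i|.
have norm_abs (z : idx -> R) : norm2 (fun i => `|z i|) ^+ 2 = \sum_i z i ^+ 2.
  by rewrite norm2_sq; apply: eq_bigr => i _; rewrite real_normK ?num_real.
have ax0 i : 0 <= ax i by apply: normr_ge0.
have ay0 i : 0 <= ay i by apply: normr_ge0.
apply: (@le_trans _ _ (\sum_u \sum_v t%:R^-1
  * (pr u v * (ax u.1 * ay u.2 * (ax v.1 * ay v.2))))).
  apply: ler_sum => u _; apply: ler_sum => v _.
  have [uu|uu] := eqVneq u.1 u.2.
    rewrite /c uu eqxx /= !mul0r mulr_ge0 ?invr_ge0 // mulr_ge0 //.
    by rewrite !mulr_ge0.
  have coll : \sum_h prod_mass p h * (H h u * H h v) <= t%:R^-1.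
    apply: le_trans (tensor_collision uu); apply: ler_sum => h _.
    by rewrite ler_wpM2l ?prod_hash_mass_ge0 // ler_piMr.
  have coll0 : 0 <= \sum_h prod_mass p h * (H h u * H h v).
    by apply: sumr_ge0 => h _; rewrite !mulr_ge0 ?prod_hash_mass_ge0.
  apply: (@le_trans _ _ (ax u.1 * ay u.2 * (ax v.1 * ay v.2)
    * (pr u v * t%:R^-1))); last first.
    by rewrite le_eqVlt; apply/orP; left; apply/eqP; ring.
  apply: le_trans (_ : `|c u * c v| * (pr u v * t%:R^-1) <= _).
    apply: (@le_trans _ _ (`|c u * c v| * (pr u v *
      \sum_h prod_mass p h * (H h u * H h v)))).
      by apply: ler_wpM2r; rewrite ?mulr_ge0 ?ler_norm.
    by apply: ler_wpM2l => //; apply: ler_wpM2l.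
  apply: ler_wpM2r; first by rewrite mulr_ge0 ?invr_ge0.
  rewrite normrM; apply: ler_pM => //; rewrite /c !normrM normr_nat.
    by rewrite ler_piMl ?mulr_ge0 // lern1; case: (_ != _).
  by rewrite ler_piMl ?mulr_ge0 // lern1; case: (_ != _).
under eq_bigr => u _ do rewrite -mulr_sumr.
rewrite -mulr_sumr mulrC [3 ^+ q / _]mulrC -mulrA [leLHS]mulrC.
apply: ler_wpM2l; first by rewrite invr_ge0.
apply: le_trans (tensor_paired_sum_le ax0 ay0 ax0 ay0) _.
rewrite -!norm_abs -/ax -/ay le_eqVlt; apply/orP; left; apply/eqP; ring.
Qed.

Lemma sum_multi_index (F : idx -> R) :
  \sum_(j < #|idx|) F (multi_index j) = \sum_i F i.
Proof. by rewrite -(big_enum_val F); apply: eq_bigl => i; rewrite inE. Qed.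

Lemma sketch_gram_error n (X : 'M[R]_(n, #|idx|)) (h : hashes) (g : signs) a b :
  let S := tensor_sketch R h g in
  (X *m S *m (X *m S)^T - X *m X^T) a b
  = cross_term h g (fun i => X a (enum_rank i)) (fun i => X b (enum_rank i)).
Proof.
move=> S; have SS i j : (S *m S^T) i j =
    tensor_sign R g (multi_index i) * tensor_sign R g (multi_index j)
    * (tensor_hash h (multi_index i) == tensor_hash h (multi_index j))%:R.
  pose col (k : idx) : 'I_t :=
    Ordinal (ltn_pmod (\sum_(l < q) h l (k l))%N t_gt0).
  have colE k : val (col k) = tensor_hash h k by [].
  rewrite mxE (bigD1 (col (multi_index i))) //= big1 ?addr0.
    by rewrite /S !mxE colE eqxx mulr1n mulr_natr mulrnAr.
  move=> c; rewrite -val_eqE colE => /negbTE cN.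
  by rewrite /S !mxE cN mulr0n mul0r.
have SS1 i : (S *m S^T) i i = 1.
  rewrite SS eqxx mulr1 /tensor_sign -big_split big1 // => l _.
  by rewrite /= -expr2 sqrr_sign.
have -> : (X *m S *m (X *m S)^T - X *m X^T) a b
    = \sum_i \sum_j X a i * (S *m S^T) i j * X b j - \sum_i X a i * X b i.
  rewrite trmx_mul -mulmxA (mulmxA S) mulmxA [LHS]mxE [X in _ + X]mxE.
  congr (_ - _); last by rewrite mxE; apply: eq_bigr => i _; rewrite mxE.
  rewrite exchange_big [LHS]mxE; apply: eq_bigr => j _ /=.
  rewrite -mulr_suml; congr (_ * _); last by rewrite mxE.
  by rewrite [LHS]mxE.
rewrite /cross_term -(pair_bigA _ (fun i j => (i != j)%:R
  * (X a (enum_rank i) * X b (enum_rank j)) * (tensor_sign R g i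
  * tensor_sign R g j * (tensor_hash h i == tensor_hash h j)%:R))) /=.
rewrite -sum_multi_index -sumrB; apply: eq_bigr => i _.
rewrite -sum_multi_index !(bigD1 (P := xpredT) i) //= SS1 mulr1 addrAC subrr.
rewrite eqxx !mul0r; congr (_ + _); apply: eq_bigr => j ji.
rewrite SS /multi_index !enum_valK (inj_eq enum_val_inj).
rewrite [i == j]eq_sym ji mul1r.
ring.
Qed.

Lemma sketch_gram_moment n (X : 'M[R]_(n, #|idx|)) :
  \sum_(h : hashes) prod_mass p h * \sum_(g : signs) prod_mass r g *
    sqfrob (X *m tensor_sketch R h g *m (X *m tensor_sketch R h g)^T - X *m X^T)
  <= 3 ^+ q / t%:R * sqfrob X ^+ 2.
Proof.
pose x a (i : idx) := X a (enum_rank i).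
have normx a : \sum_i x a i ^+ 2 = \sum_j X a j ^+ 2.
  rewrite -sum_multi_index; apply: eq_bigr => j _.
  by rewrite /x /multi_index enum_valK.
apply: (@le_trans _ _ (\sum_a \sum_b 3 ^+ q / t%:R
  * ((\sum_i x a i ^+ 2) * (\sum_i x b i ^+ 2)))); last first.
  rewrite /sqfrob expr2 mulr_suml mulr_sumr; apply: ler_sum => a _.
  by under eq_bigr => b _ do rewrite !normx; rewrite -!mulr_sumr.
under eq_bigr => h _.
  have -> : \sum_(g : signs) prod_mass r g * sqfrob (X *m tensor_sketch R h g
      *m (X *m tensor_sketch R h g)^T - X *m X^T)
    = \sum_a \sum_b \sum_g prod_mass r g * cross_term h g (x a) (x b) ^+ 2.
    rewrite (eq_bigr (fun g => \sum_a \sum_b prod_mass r g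
      * cross_term h g (x a) (x b) ^+ 2)); last first.
      move=> g _; rewrite mulr_sumr; apply: eq_bigr => a _.
      by rewrite mulr_sumr; apply: eq_bigr => b _; rewrite sketch_gram_error.
    rewrite exchange_big; apply: eq_bigr => a _.
    by rewrite exchange_big.
  rewrite mulr_sumr; over.
rewrite exchange_big; apply: ler_sum => a _.
under eq_bigr => h _ do rewrite mulr_sumr.
rewrite exchange_big; apply: ler_sum => b _.
exact: cross_term_moment.
Qed.

End SketchMoment.

(** * Means of products of random variables *)

Section Means.
Variables (R : realType) (disp : measure_display) (T : measurableType disp).
Variable P : probability T R.

Definition has_mean (f : T -> R) (m : R) : Prop :=
  P.-integrable setT (EFin \o f) /\ 'E_P[f]%E = m%:E.

Lemma has_mean_cst (m : R) : has_mean (fun=> m) m.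
Proof.
split; last by rewrite (expectation_cst P m).
exact: (finite_measure_integrable_cst P m measurableT).
Qed.

Lemma has_meanD f g m1 m2 : has_mean f m1 -> has_mean g m2 ->
  has_mean (fun w => f w + g w) (m1 + m2).
Proof.
move=> [fi fm] [gi gm]; split.
  by apply: eq_integrable (integrableD measurableT fi gi).
have := expectationD (P := P) (X := f) (Y := g).
rewrite fm gm; apply; exact/Lfun1_integrable.
Qed.

Lemma has_meanZ c f m : has_mean f m -> has_mean (fun w => c * f w) (c * m).
Proof.
move=> [fi fm]; split.
  by apply: eq_integrable (integrableZl measurableT c fi).
have -> : (fun w => c * f w) = (c \o* f)%R.
  by apply/funext => w /=; rewrite mulrC.
by rewrite expectationZl ?fm //; exact/Lfun1_integrable.
Qed.

Lemma has_mean_sum (I : finType) (f : I -> T -> R) (m : I -> R) :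
  (forall i, has_mean (f i) (m i)) ->
  has_mean (fun w => \sum_i f i w) (\sum_i m i).
Proof.
move=> fm; elim: (index_enum I) => [|i s IH].
  by under eq_fun do rewrite big_nil; rewrite big_nil; apply: has_mean_cst.
under eq_fun do rewrite big_cons; rewrite big_cons.
exact: has_meanD (fm i) IH.
Qed.

Lemma has_mean_sqr (X : {RV P >-> R}) (s : R) :
  'E_P[X]%E = 0%E -> 'V_P[X]%E = s%:E ->
  has_mean (fun w => X w * X w) s.
Proof.
move=> X0; rewrite /variance unlock X0 /= => Vs.
have Es : 'E_P[(fun w => X w * X w)%R]%E = s%:E.
  by rewrite -Vs; congr expectation; apply/funext => w;
     rewrite -[RHS]/((X w - 0) * (X w - 0)) subr0.
split=> //; apply/integrableP; split.
  by apply/measurable_EFinP; apply: measurable_funM.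
rewrite (_ : (\int[P]_x _)%E = s%:E) ?ltry // -Es unlock.
by apply: eq_integral => w _ /=; rewrite ger0_norm // -expr2 sqr_ge0.
Qed.

(** This follows from 2|xy| <= x^2 + y^2. *)
Lemma has_mean_integrableM (X Y : {RV P >-> R}) s s' :
  has_mean (fun w => X w * X w) s -> has_mean (fun w => Y w * Y w) s' ->
  P.-integrable setT (EFin \o (fun w => X w * Y w)).
Proof.
move=> hX hY; have [XY _] := has_meanD hX hY.
apply: le_integrable XY => //.
  by apply/measurable_EFinP; apply: measurable_funM.
move=> w _ /=; rewrite lee_fin.
rewrite normrM [leRHS]ger0_norm ?addr_ge0 -?expr2 ?sqr_ge0 //.
have := sqr_ge0 (`|X w| - `|Y w|).
rewrite sqrrB !real_normK ?num_real //.
have : 0 <= `|X w| * `|Y w| by rewrite mulr_ge0.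
rewrite -mulr_natr; lra.
Qed.

(** This follows from 2|x| <= x^2 + 1. *)
Lemma has_mean_integrable (X : {RV P >-> R}) s :
  has_mean (fun w => X w * X w) s -> P.-integrable setT (EFin \o X).
Proof.
move=> hX; have [X1 _] := has_meanD hX (has_mean_cst 1).
apply: le_integrable X1 => //; first by apply/measurable_EFinP.
move=> w _ /=; rewrite lee_fin.
rewrite [leRHS]ger0_norm ?addr_ge0 -?expr2 ?sqr_ge0 //.
have := sqr_ge0 (`|X w| - 1); rewrite sqrrB1 real_normK ?num_real //.
have := normr_ge0 (X w); rewrite -mulr_natr; lra.
Qed.

(** Independence makes the joint law of X and Y the product of their laws, so
    Fubini separates the two factors. *)
Lemma has_mean_indepM (X Y : {RV P >-> R}) :
  (forall A B, measurable A -> measurable B ->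
    P (X @^-1` A `&` Y @^-1` B) = (P (X @^-1` A) * P (Y @^-1` B))%E) ->
  P.-integrable setT (EFin \o (fun w => X w * Y w)) ->
  P.-integrable setT (EFin \o Y) -> 'E_P[Y]%E = 0%E ->
  has_mean (fun w => X w * Y w) 0.
Proof.
move=> indep XYi Yi Y0; split=> //.
pose Z (w : T) := (X w, Y w).
have mZ : measurable_fun setT Z by apply: measurable_fun_pair.
pose ZM : {mfun T >-> _} := HB.pack Z (isMeasurableFun.Build _ _ _ _ Z mZ).
pose f (z : R * R) : \bar R := (z.1 * z.2)%:E.
have mf : measurable_fun setT f.
  by apply/measurable_EFinP; apply: measurable_funM.
rewrite unlock.
transitivity (\int[distribution P ZM]_z f z)%E.
  by rewrite integral_distribution.
have prodE A : measurable A ->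
    (distribution P X \x distribution P Y)%E A = distribution P ZM A.
  by apply: product_measure_unique => B C mB mC; rewrite /= -indep.
have fi : (distribution P X \x distribution P Y)%E.-integrable setT f.
  have /integrableP[_ fin] := integrable_pushforward mZ mf XYi measurableT.
  apply/integrableP; split=> //; apply: le_lt_trans fin.
  rewrite le_eqVlt; apply/orP; left; apply/eqP.
  by apply: eq_measure_integral => A mA _; apply: prodE.
transitivity (\int[(distribution P X \x distribution P Y)%E]_z f z)%E.
  by apply: eq_measure_integral => A mA _; apply/esym/prodE.
rewrite -integral12_prod_meas1 //.
apply: integral0_eq => x _.
have mE : measurable_fun [set: R] (@EFin R) by exact/measurable_EFinP.
have EY : (\int[distribution P Y]_y y%:E = 0)%E.
  by rewrite (integral_distribution (f := @EFin R)) // -Y0 unlock.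
rewrite /fubini_F /f /=; under eq_integral => y _ do rewrite EFinM.
rewrite integralZl ?EY ?mule0 //.
have mY : measurable_fun setT Y by [].
exact: (integrable_pushforward mY mE Yi measurableT).
Qed.

End Means.

(** * Bias and variance under white noise *)

Section Noise.
Variables (R : realType) (disp : measure_display) (T : measurableType disp).
Variables (P : probability T R) (n : nat) (xi : 'I_n -> {RV P >-> R}).
Variable sigma : R.
Hypothesis xi_mean : forall i, ('E_P[xi i] = 0)%E.
Hypothesis xi_var : forall i, ('V_P[xi i] = (sigma ^+ 2)%:E)%E.
Hypothesis xi_indep : indep_families P (fun i => rv_events (xi i) measurable).

Lemma noise_indep i j A B : i != j -> measurable A -> measurable B ->
  P (xi i @^-1` A `&` xi j @^-1` B) = (P (xi i @^-1` A) * P (xi j @^-1` B))%E.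
Proof.
move=> ij mA mB.
pose E k := xi k @^-1` (if k == i then A else B).
have hE k : rv_events (xi k) measurable (E k).
  by exists (if k == i then A else B) => //; case: ifP.
have := xi_indep hE [set i; j]%SET.
rewrite big_setU1 ?inE //= big_set1 /E eqxx eq_sym (negbTE ij) => <-.
congr (P _); apply/seteqP; split=> [w [wA wB] k|w hw].
  by rewrite /= !inE => /orP[] /eqP->; rewrite ?eqxx // eq_sym (negbTE ij).
have := hw i; have := hw j; rewrite /= !inE !eqxx orbT eq_sym (negbTE ij).
by move=> /(_ isT) wj /(_ isT) wi; split.
Qed.

Lemma noise_covariance i j :
  has_mean P (fun w => xi i w * xi j w) (if i == j then sigma ^+ 2 else 0).
Proof.
have sq k := has_mean_sqr (xi_mean k) (xi_var k).
case: eqP => [<-|/eqP ij]; first exact: sq.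
apply: has_mean_indepM => //; first by move=> A B; apply: noise_indep.
  exact: has_mean_integrableM (sq i) (sq j).
exact: has_mean_integrable (sq j).
Qed.

(** In the expanded square the terms that are linear in the noise have mean
    zero and distinct noise entries are uncorrelated, so that only the constant
    and the squares of single entries survive. *)
Lemma noise_sqnorm_mean m (c : 'cV[R]_m) (B : 'M[R]_(m, n)) (N : R) :
  ('E_P[fun w => (sqnorm2 (c + B *m \col_i xi i w) / N)%R]
   = ((sqnorm2 c + sigma ^+ 2 * sqfrob B) / N)%:E)%E.
Proof.
have xi0 i : has_mean P (xi i) 0.
  split=> //; apply: has_mean_integrable.
  exact: has_mean_sqr (xi_mean i) (xi_var i).
pose f a w := c a 0 ^+ 2 + \sum_i 2 * c a 0 * B a i * xi i w
  + \sum_i \sum_j B a i * B a j * (xi i w * xi j w).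
have fE w : sqnorm2 (c + B *m \col_i xi i w) / N = N^-1 * \sum_a f a w.
  rewrite mulrC; congr (_ * _); apply: eq_bigr => a _.
  have -> : (c + B *m \col_i xi i w) a 0 = c a 0 + \sum_i B a i * xi i w.
    by rewrite !mxE; congr (_ + _); apply: eq_bigr => i _; rewrite mxE.
  rewrite sqrrD /f; congr (_ + _ + _).
    by rewrite -mulr_natl !mulr_sumr; apply: eq_bigr => i _; ring.
  rewrite expr2 mulr_suml; apply: eq_bigr => i _.
  by rewrite mulr_sumr; apply: eq_bigr => j _; ring.
under eq_fun do rewrite fE.
have -> : (sqnorm2 c + sigma ^+ 2 * sqfrob B) / N = N^-1 * \sum_a
  (c a 0 ^+ 2 + \sum_i 2 * c a 0 * B a i * 0
  + \sum_i \sum_j B a i * B a j * (if i == j then sigma ^+ 2 else 0)).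
  rewrite mulrC; congr (_ * _); rewrite mulr_sumr -big_split /=.
  apply: eq_bigr => a _; rewrite -addrA; congr (_ + _).
  have -> : \sum_i 2 * c a 0 * B a i * 0 = 0.
    by apply: big1 => i _; rewrite mulr0.
  rewrite add0r mulr_sumr; apply: eq_bigr => i _.
  rewrite (bigD1 i) //= eqxx big1 ?addr0 => [|j /negbTE ji].
    by rewrite -expr2 mulrC.
  by rewrite eq_sym ji mulr0.
suff [] : has_mean P (fun w => N^-1 * \sum_a f a w) (N^-1 * \sum_a
  (c a 0 ^+ 2 + \sum_i 2 * c a 0 * B a i * 0
  + \sum_i \sum_j B a i * B a j * (if i == j then sigma ^+ 2 else 0))) by [].
apply: has_meanZ; apply: has_mean_sum => a; apply: has_meanD.
  apply: has_meanD; first exact: has_mean_cst.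
  by apply: has_mean_sum => i; apply: has_meanZ.
apply: has_mean_sum => i; apply: has_mean_sum => j; apply: has_meanZ.
exact: noise_covariance.
Qed.

End Noise.

(** * Finite-valued random variables and tensor sketches *)

Section FiniteLaw.
Variables (R : realType) (disp : measure_display) (T : measurableType disp).
Variable P : probability T R.

Definition point_mass (U : Type) (X : T -> U) (u : U) : R :=
  fine (P (X @^-1` [set u])).

Lemma point_mass_ge0 (U : Type) (X : T -> U) u : 0 <= point_mass X u.
Proof. exact: fine_ge0. Qed.

Lemma finite_law (U : finType) (X : T -> U) (A : pred U) :
  (forall u, measurable (X @^-1` [set u])) ->
  P [set w | A (X w)] = (\sum_(u | A u) point_mass X u)%:E.
Proof.
move=> mX.
have -> : [set w | A (X w)] = \bigcup_(u in [set` A]) X @^-1` [set u].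
  apply/seteqP; split=> [w Aw|w [u /= Au Xw]]; first by exists (X w).
  by rewrite /= Xw.
rewrite measure_fin_bigcup //; last by move=> u v _ _ [w [/= <- <-]].
rewrite -(@bigfs _ _ _ _ (index_enum U) A) ?index_enum_uniq //; last first.
  by move=> u _; rewrite mem_index_enum.
rewrite -sumEFin; apply: eq_bigr => u _; rewrite /point_mass fineK //.
exact: fin_num_measure.
Qed.

Lemma point_mass_total (U : finType) (X : T -> U) :
  (forall u, measurable (X @^-1` [set u])) -> \sum_u point_mass X u = 1.
Proof.
move=> mX; have := finite_law predT mX.
rewrite (_ : [set w | _] = setT); last by apply/seteqP; split.
by rewrite probability_setT => -[].
Qed.

(** Markov's inequality read off from the finite law: every outcome outside
    good carries a loss above tau. *)
Lemma finite_markov (U : finType) (X : T -> U) (L : U -> R) (tau delta : R)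
    (good : U -> Prop) : (forall u, measurable (X @^-1` [set u])) ->
  (forall u, 0 <= L u) -> 0 < tau ->
  \sum_u point_mass X u * L u <= delta * tau ->
  (forall u, L u <= tau -> good u) ->
  ((1 - delta)%:E <= P [set w | good (X w)])%E.
Proof.
move=> mX L0 tau0 EL goodL.
have -> : [set w | good (X w)] = [set w | `[< good (X w) >]].
  by apply/seteqP; split=> w /= /asboolP.
rewrite (finite_law (fun u => `[< good u >]) mX) lee_fin lerBlDr.
rewrite -(point_mass_total mX) (bigID (fun u => `[< good u >])) /= lerD2l.
rewrite -(ler_pM2r tau0); apply: le_trans EL; rewrite mulr_suml.
rewrite [leRHS](bigID (fun u => `[< good u >])) /= -[leLHS]add0r lerD //.
  by apply: sumr_ge0 => u _; rewrite mulr_ge0 ?point_mass_ge0.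
apply: ler_sum => u /asboolP bad; apply: ler_wpM2l; first exact: point_mass_ge0.
by rewrite leNgt; apply/negP => /ltW /goodL.
Qed.

Lemma kwise_independent_mass k d (V : finType) (h : T -> {ffun 'I_d -> V}) :
  (forall B, measurable (h @^-1` B)) -> kwise_independent P k h ->
  kwise_mass k (point_mass h).
Proof.
move=> mh hk S Sk c.
have := finite_law (fun y : {ffun 'I_d -> V} => [forall i in S, y i == c i])
  (fun y => mh [set y]).
rewrite (_ : [set w | _] = [set w | forall i, i \in S -> h w i = c i]).
  by rewrite hk // => -[].
apply/seteqP; split=> w /=; first by move=> /forall_inP hS i /hS /eqP.
by move=> hS; apply/forall_inP => i /hS ->.
Qed.

Section Joint.
Variables (I U1 U2 : finType) (h : I -> T -> U1) (g : I -> T -> U2).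

Definition joint (w : T) : {ffun I -> U1} * {ffun I -> U2} :=
  ([ffun l => h l w], [ffun l => g l w]).

Lemma joint_preimage y z : joint @^-1` [set (y, z)] =
  \bigcap_(a in [set` [set: I + I]%SET]) match a with
    | inl l => h l @^-1` [set y l] | inr l => g l @^-1` [set z l] end.
Proof.
apply/seteqP; split=> [w [yw zw] [] l _|w hw]; rewrite /= -?yw -?zw ?ffunE //.
rewrite /joint; congr (_, _); apply/ffunP => l; rewrite ffunE.
  by apply: (hw (inl l)); rewrite /= inE.
by apply: (hw (inr l)); rewrite /= inE.
Qed.

Hypothesis mh : forall l B, measurable (h l @^-1` B).
Hypothesis mg : forall l B, measurable (g l @^-1` B).

Lemma joint_measurable u : measurable (joint @^-1` [set u]).
Proof.
case: u => y z; rewrite joint_preimage.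
by apply: fin_bigcap_measurable => // -[] l _.
Qed.

Lemma point_mass_indep (y : {ffun I -> U1}) (z : {ffun I -> U2}) :
  indep_families P (fun a : I + I =>
        match a with
        | inl l => rv_events (h l) discrete_measurable
        | inr l => rv_events (g l) discrete_measurable
        end) ->
  point_mass joint (y, z) = prod_mass (fun l => point_mass (h l)) y
                            * prod_mass (fun l => point_mass (g l)) z.
Proof.
move=> ind; rewrite {1}/point_mass joint_preimage ind; last first.
  by case=> l; [exists [set y l] | exists [set z l]].
rewrite (eq_bigl predT) => [|a]; last by rewrite inE.
have fin A : measurable A -> P A = (fine (P A))%:E.
  by move=> mA; rewrite fineK // fin_num_measure.
rewrite big_sumType /=.
rewrite (eq_bigr (fun l => (point_mass (h l) (y l))%:E)) => [|l _].
  2: by apply: fin.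
rewrite [X in (_ * X)%E](eq_bigr (fun l => (point_mass (g l) (z l))%:E)).
  by rewrite !prodEFin.
by move=> l _; apply: fin.
Qed.

End Joint.

(** Markov's inequality for the squared Frobenius error of the sketched Gram
    matrix.  A sketch takes finitely many values, so every property of it is
    an event. *)
Lemma tensor_sketch_whp n d q t (S : T -> 'M[R]_(#|{ffun 'I_q -> 'I_d}|, t))
    (X : 'M[R]_(n, #|{ffun 'I_q -> 'I_d}|)) (tau delta : R)
    (good : 'M[R]_(#|{ffun 'I_q -> 'I_d}|, t) -> Prop) :
  is_tensor_sketch P S -> (0 < t)%N -> 0 < tau ->
  3 ^+ q / t%:R * sqfrob X ^+ 2 <= delta * tau ->
  (forall M, sqfrob (X *m M *m (X *m M)^T - X *m X^T) <= tau -> good M) ->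
  ((1 - delta)%:E <= P [set w | good (S w)])%E.
Proof.
move=> [h [g [[mh mg] hk gk ind SE]]] t0 tau0 bound goodM.
pose sk (u : {ffun 'I_q -> {ffun 'I_d -> 'I_t}}
             * {ffun 'I_q -> {ffun 'I_d -> bool}}) := tensor_sketch R u.1 u.2.
have Ssk w : S w = sk (joint h g w).
  rewrite SE /sk /=; congr (tensor_sketch _ _ _); apply/funext => l;
  by rewrite ffunE.
have -> : [set w | good (S w)] = [set w | (good \o sk) (joint h g w)].
  by apply/seteqP; split=> w /=; rewrite Ssk.
apply: (finite_markov
  (L := fun u => sqfrob (X *m sk u *m (X *m sk u)^T - X *m X^T))).
- exact: joint_measurable.
- by move=> u; apply: sqfrob_ge0.
- exact: tau0.
- apply: le_trans bound.
  apply: le_trans (sketch_gram_moment (p := fun l => point_mass (h l))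
    (r := fun l => point_mass (g l)) t0 _ _ _ X).
  + rewrite [leLHS](_ : _ = \sum_y \sum_z point_mass (joint h g) (y, z) * sqfrob
      (X *m sk (y, z) *m (X *m sk (y, z))^T - X *m X^T)); last first.
      by rewrite pair_bigA; apply: eq_bigr => -[].
    rewrite le_eqVlt; apply/orP; left; apply/eqP; apply: eq_bigr => y _.
    rewrite mulr_sumr; apply: eq_bigr => z _.
    by rewrite point_mass_indep // mulrA.
  + by move=> l y; apply: point_mass_ge0.
  + by move=> l; apply: kwise_independent_mass.
  + by move=> l; apply: kwise_independent_mass.
- by move=> u uL; apply: goodM.
Qed.

End FiniteLaw.

(** * Kernel regression with a tensor sketch *)

(** The sum over multi-indices of a product of coordinates is a power of a
    sum: this is the kernel trick for monomial features. *)
Lemma kernel_gram (R : realType) n d q (A : 'M[R]_(n, d)) :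
  kernel_mx q A = feature_mx q A *m (feature_mx q A)^T.
Proof.
apply/matrixP => i j; rewrite !mxE /poly_kernel mxE.
rewrite -[LHS]/((\sum_c row i A 0 c * (row j A)^T c 0) ^+ q).
under [in RHS]eq_bigr => m _.
  rewrite !mxE.
  over.
rewrite (sum_multi_index (fun x : {ffun 'I_q -> 'I_d} =>
  (\prod_l row i A 0 (x l)) * \prod_l row j A 0 (x l))).
under [in RHS]eq_bigr => x _ do rewrite -big_split.
rewrite -(bigA_distr_bigA (fun _ c => row i A 0 c * row j A 0 c)).
rewrite prodr_const card_ord; congr (_ ^+ _).
by apply: eq_bigr => c _; rewrite !mxE.
Qed.

(** The risk is the squared distance from X x to f plus a constant, and full row
    rank allows the distance to vanish. *)
Lemma min_norm_fit (R : realType) (disp : measure_display)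
    (T : measurableType disp) (P : probability T R) n p (X : 'M[R]_(n, p))
    (f : 'cV[R]_n) (sigma : R) (xi : 'I_n -> {RV P >-> R}) (x : 'cV[R]_p) :
  (0 < n)%N -> row_free X ->
  (forall i, 'E_P[xi i] = 0)%E ->
  (forall i, 'V_P [xi i] = (sigma ^+ 2)%:E)%E ->
  indep_families P (fun i => rv_events (xi i) measurable) ->
  min_norm_minimizer (risk P X (fun w => f + \col_i xi i w)) x -> X *m x = f.
Proof.
move=> n0 rfX xi0 xiv xind [xmin _].
have riskE y : risk P X (fun w => f + \col_i xi i w) y
    = ((sqnorm2 (X *m y - f) + sigma ^+ 2 * sqfrob (- 1%:M : 'M[R]_n))
       / n%:R)%:E.
  rewrite -(noise_sqnorm_mean xi0 xiv xind); congr expectation.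
  by apply/funext => w; rewrite mulNmx mul1mx opprD addrA.
have := xmin (pinvmx X *m f); rewrite !riskE mulmxA mulmxVp // mul1mx subrr.
rewrite lee_fin ler_pM2r ?invr_gt0 ?ltr0n // lerD2r => h.
apply/eqP; rewrite -subr_eq0; apply/eqP/sqnorm2_eq0; apply: le_trans h _.
by rewrite /sqnorm2 big1 // => i _; rewrite mxE expr0n.
Qed.

(** The residual of Q differs from that of P by (Q - P) f, of norm at most
    nu |f|, and the residual of P has norm at most |f|. *)
Lemma bias_perturbation (R : realType) n (P Q : 'M[R]_n) (f : 'cV[R]_n)
    (nu : R) : 0 <= nu -> orthoproj P -> sqfrob (P - Q) <= nu ^+ 2 ->
  sqnorm2 (Q *m f - f)
  <= sqnorm2 (P *m f - f) + (2 * nu + nu ^+ 2) * sqnorm2 f.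
Proof.
move=> nu0 hP PQ.
have -> : Q *m f - f = (P *m f - f) + (Q - P) *m f.
  by rewrite mulmxBl [RHS]addrC addrA subrK.
apply: sqnorm2_add_le; rewrite ?sqnorm2_ge0 //.
  have [Ct CC] := orthoprojC hP.
  have := orthoproj_trace_ge0 f hP.
  have -> : sqnorm2 (P *m f - f) = sqnorm2 f - \tr (f^T *m P *m f).
    have -> : P *m f - f = - ((1%:M - P) *m f) by rewrite mulmxBl mul1mx opprB.
    rewrite !sqnorm2_frob sqfrobN !sqfrob_trace.
    rewrite trmx_mul Ct mulmxA -(mulmxA _ _ (1%:M - P)) CC.
    by rewrite mulmxBr mulmx1 mulmxBl linearB.
  by rewrite gerBl.
apply: le_trans (sqnorm2_mulmx _ _) _; rewrite ler_wpM2r ?sqnorm2_ge0 //.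
by rewrite -sqfrobN opprB.
Qed.

Theorem theorem19 (R : realType) :
  exists2 C : R, 0 < C &
  forall (n d q k t : nat) (A : 'M[R]_(n, d)) (lam : seq R)
    (f : 'cV[R]_n) (sigma nu delta : R)
    (disp : measure_display) (T : measurableType disp) (P : probability T R)
    (xi : 'I_n -> {RV P >-> R})
    (S : T -> 'M[R]_(#|{ffun 'I_q -> 'I_d}|, t)),
  let Phi := feature_mx q A in
  let K := kernel_mx q A in
  let b := fun w : T => f + \col_i xi i w in
  let gap := lam`_(k.-1) - lam`_k in
  (1 <= q)%N ->
  row_free Phi ->
  ordered_eigenvalues K lam ->
  (1 <= k < n)%N ->
  lam`_k < lam`_(k.-1) ->
  (forall i, 'E_P[xi i] = 0)%E ->
  (forall i, 'V_P [xi i] = (sigma ^+ 2)%:E)%E ->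
  indep_families P (fun i => rv_events (xi i) measurable) ->
  0 < nu < 1 / 2 ->
  0 < delta < 1 / 2 ->
  is_tensor_sketch P S ->
  indep2 P (rv_events S discrete_measurable) (rv_events b (@cV_borel R n)) ->
  C * (3 ^+ q * (\tr K) ^+ 2 / (gap ^+ 2 * nu ^+ 2 * delta)) <= t%:R ->
  forall (xstar : 'cV[R]_(#|{ffun 'I_q -> 'I_d}|))
    (V : 'M[R]_(#|{ffun 'I_q -> 'I_d}|, k)),
  min_norm_minimizer (risk P Phi b) xstar ->
  top_right_singular Phi V ->
  ((1 - delta)%:E <=
   P [set w | forall VS : 'M[R]_(t, k),
       top_right_singular (Phi *m S w) VS ->
       excess_risk P Phi xstar
         (fun w' => sketched_pcr_sol Phi (S w) VS (b w'))
       <= excess_risk P Phi xstar (fun w' => pcr_sol Phi V (b w'))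
          + ((2 * nu + nu ^+ 2) * sqnorm2 f / n%:R)%:E])%E.
Proof.
exists 4 => //.
move=> n d q k t A lam f sigma nu delta disp T P xi S Phi K b gap.
move=> q1 rfPhi eigK kn gap_pos xi0 xiv xind /andP[nu0 _] /andP[delta0 _].
move=> sk _ bound xstar V minx topV; have /andP[k0 k_lt_n] := kn.
have n0 : (0 < n)%N by apply: leq_ltn_trans k_lt_n.
have [t_eq0|t0] := posnP t.
  (* Without columns there is no top-k singular matrix at all. *)
  subst t; rewrite (_ : [set w | _] = setT).
    by rewrite probability_setT lee_fin gerBl ltW.
  apply/seteqP; split=> // w _ VS [? [? [? [hk _]]]].
  by move: hk; rewrite minn0 leqNgt k0.
have fit := min_norm_fit n0 rfPhi xi0 xiv xind minx.
have gap0 : 0 < gap by rewrite subr_gt0.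
have excessE m (Q : 'M[R]_n) (theta : T -> 'cV[R]_m) (Y : 'M[R]_(n, m)) x :
    Y *m x = f -> (forall w, Y *m theta w = Q *m b w) ->
    excess_risk P Y x theta
    = ((sqnorm2 (Q *m f - f) + sigma ^+ 2 * sqfrob Q) / n%:R)%:E.
  move=> Yx Ytheta; rewrite -(noise_sqnorm_mean xi0 xiv xind).
  congr expectation; apply/funext => w.
  by rewrite Ytheta Yx /b mulmxDr addrAC.
have eigPhi : ordered_eigenvalues (Phi *m Phi^T) lam by rewrite -kernel_gram.
have trK : \tr K = sqfrob Phi.
  by rewrite /K kernel_gram sqfrob_trace mxtrace_mulC.
(* An error of squared size tau in the Gram matrix lets the two projections
   differ by at most nu in Frobenius norm. *)
pose tau := gap ^+ 2 * nu ^+ 2 / 4.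
have tau0 : 0 < tau by rewrite !mulr_gt0 ?exprn_gt0.
apply: (tensor_sketch_whp (X := Phi) (tau := tau) (good := fun M =>
  forall VS : 'M[R]_(t, k), top_right_singular (Phi *m M) VS ->
    (excess_risk P Phi xstar (fun w' => sketched_pcr_sol Phi M VS (b w'))
    <= excess_risk P Phi xstar (fun w' => pcr_sol Phi V (b w'))
       + ((2 * nu + nu ^+ 2) * sqnorm2 f / n%:R)%:E)%E) sk t0 tau0).
  have den0 : 0 < gap ^+ 2 * nu ^+ 2 * delta by rewrite !mulr_gt0 ?exprn_gt0.
  move: bound; rewrite trK -(ler_pM2r den0) mulrA mulfVK ?gt_eqF // => bound.
  rewrite mulrAC ler_pdivrMr ?ltr0n //.
  have -> : delta * tau * t%:R = t%:R * (gap ^+ 2 * nu ^+ 2 * delta) / 4.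
    by rewrite /tau; field.
  by rewrite ler_pdivlMr // mulrC.
move=> M close VS topVS.
have hP := pcproj_orthoproj topV; have hQ := pcproj_orthoproj topVS.
have trQ := pcproj_trace topVS.
have [trP _] := pcproj_gap rfPhi kn eigPhi gap_pos topV hQ trQ.
have PQ : sqfrob (pcproj Phi V - pcproj (Phi *m M) VS) <= nu ^+ 2.
  have := pcproj_davis_kahan rfPhi kn eigPhi gap_pos topV topVS.
  rewrite -/gap => dk; rewrite -(ler_pM2l (exprn_gt0 2 gap0)).
  apply: le_trans dk _; rewrite -ler_pdivlMl // mulrC.
  exact: close.
rewrite (excessE _ (pcproj (Phi *m M) VS)) //; last first.
  by move=> w; rewrite /sketched_pcr_sol /pcproj !mulmxA.
rewrite (excessE _ (pcproj Phi V)) //; last first.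
  by move=> w; rewrite /pcr_sol /pcproj !mulmxA.
rewrite -EFinD lee_fin -mulrDl ler_pM2r ?invr_gt0 ?ltr0n //.
rewrite (orthoproj_trace hP) (orthoproj_trace hQ) trP addrAC.
apply: lerD; last by rewrite ler_wpM2l ?sqr_ge0.
exact: bias_perturbation (ltW nu0) hP PQ.
Qed.
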